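(* There exists a universal constant $K>0$ such that the following holds. Let $N\ge 20$, let $\mathbf W=[w(i,j,k,\ell)]\in\mathbb R^{N\times N\times N\times N}$ be a fixed tensor, let $\pi$ be uniformly distributed over $\mathcal S_N$, and let $Q_w=\sum_{i,j\in[N]}w(i,j,\pi(i),\pi(j))$. Then for any $t>0$, $$\mathrm P\big(Q_w-\mathrm E[Q_w]\ge t\big)\le\exp\Big(-\frac{Kt^2}{V_a+B_at}\Big)+\exp\Big(-\frac{Kt^2}{V_d+B_dt}\Big),$$ where $$B_a:=N\max_{i,j\in[N]}|a_w(i,j)|,\qquad V_a:=N\sum_{i,j\in[N]}a_w(i,j)^2,$$ $$B_d:=\max_{\sigma\in\mathcal S_N}\Big\|\big[d_w(i,j,\sigma(i),\sigma(j))\big]_{i,j}\Big\|_{\mathsf{op}},\qquad V_d:=\frac1N\sum_{i,k\in[N]}\xi_w(i,k)^2+\frac1{N^2}\sum_{\substack{i,j,k,\ell\in[N]\\ i\neq j,\ k\neq\ell}}d_w(i,j,k,\ell)^2,$$ $$\xi_w(i,k):=d_w(i,i,k,k)-\frac1N\sum_{k'=1}^N d_w(i,i,k',k')-\frac1N\sum_{i'=1}^N d_w(i',i',k,k)+\frac1{N^2}\sum_{i',k'\in[N]}d_w(i',i',k',k'),$$ and $a_w$, $d_w$ are the matrix and the tensor derived from $w$ as defined in the context.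
   Context: $[N]=\{1,\dots,N\}$ and $\mathcal S_N$ is the group of permutations of $[N]$; $\|\cdot\|_{\mathsf{op}}$ is the spectral (operator) norm; $[\,\cdot\,]_{i,j}$ denotes the $N\times N$ matrix with the indicated $(i,j)$ entry. ''Universal constant'' means that $K$ does not depend on $N,\mathbf W,t$. Dot notation: replacing arguments of $w$ by dots means averaging over those arguments, each over $[N]$ independently, e.g. $w(i,j,k,\cdot)=\frac1N\sum_{\ell=1}^N w(i,j,k,\ell)$, $w(i,j,\cdot,\cdot)=\frac1{N^2}\sum_{k,\ell=1}^N w(i,j,k,\ell)$, $w(i,\cdot,\cdot,\cdot)=\frac1{N^3}\sum_{j,k,\ell=1}^N w(i,j,k,\ell)$, $w(\cdot,\cdot,\cdot,\cdot)=\frac1{N^4}\sum_{i,j,k,\ell=1}^N w(i,j,k,\ell)$, and similarly for the other positions. For $i,j\in[N]$, $$a_w(i,j):=w(i,\cdot,j,\cdot)-w(i,\cdot,\cdot,\cdot)-w(\cdot,\cdot,j,\cdot)+w(\cdot,\cdot,\cdot,\cdot)+w(\cdot,i,\cdot,j)-w(\cdot,i,\cdot,\cdot)-w(\cdot,\cdot,\cdot,j)+w(\cdot,\cdot,\cdot,\cdot).$$ For $i,j,k,\ell\in[N]$, $$\begin{aligned}d_w(i,j,k,\ell):={}&w(i,j,k,\ell)-w(i,\cdot,\cdot,\cdot)-w(\cdot,j,\cdot,\cdot)-w(\cdot,\cdot,k,\cdot)-w(\cdot,\cdot,\cdot,\ell)\\&+w(i,j,\cdot,\cdot)+w(i,\cdot,k,\cdot)+w(i,\cdot,\cdot,\ell)+w(\cdot,j,k,\cdot)+w(\cdot,j,\cdot,\ell)+w(\cdot,\cdot,k,\ell)\\&-w(i,j,k,\cdot)-w(i,j,\cdot,\ell)-w(i,\cdot,k,\ell)-w(\cdot,j,k,\ell)+w(\cdot,\cdot,\cdot,\cdot).\end{aligned}$$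 *)

(* Defs.v *)
From HB Require Import structures.
From mathcomp Require Import all_boot all_order all_algebra all_fingroup.
From mathcomp Require Import all_classical all_reals all_analysis.

Set Implicit Arguments.
Unset Strict Implicit.
Unset Printing Implicit Defensive.

Import Order.TTheory GRing.Theory Num.Theory.

Local Open Scope classical_set_scope.
Local Open Scope ring_scope.

Section OperatorNorm.
Variable R : realType.

Definition euclidean_norm n (x : 'cV[R]_n) : R :=
  Num.sqrt (\sum_(i < n) x i 0 ^+ 2).

(* [`|A|] on matrices is the largest absolute entry in the library, hence this
   separate definition of the spectral norm. *)
Definition op_norm n (A : 'M[R]_n) : R :=
  sup [set euclidean_norm (A *m x) | x in [set x | euclidean_norm x <= 1]].

End OperatorNorm.

Section DoublyIndexedStatistic.
Variables (R : realType) (N : nat).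
Implicit Types w : 'I_N -> 'I_N -> 'I_N -> 'I_N -> R.

Definition Q w (s : 'S_N) : R := \sum_i \sum_j w i j (s i) (s j).

(* Dot notation: [Some i] fixes an argument at [i], whereas [None] is a dot and
   averages over [N] values; e.g. w(i, ., k, .) is
   [dotted w (Some i) None (Some k) None]. *)
Definition at_or_mean (o : option 'I_N) (f : 'I_N -> R) : R :=
  if o is Some i then f i else N%:R^-1 * \sum_i f i.

Definition dotted w (i j k l : option 'I_N) : R :=
  at_or_mean i (fun i' => at_or_mean j (fun j' =>
    at_or_mean k (fun k' => at_or_mean l (fun l' => w i' j' k' l')))).

Local Notation dot := (@None 'I_N).
Local Notation fix_ := (@Some 'I_N).

Definition a_of w (i j : 'I_N) : R :=
  let m := dotted w in
  m (fix_ i) dot (fix_ j) dot - m (fix_ i) dot dot dot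
  - m dot dot (fix_ j) dot + m dot dot dot dot
  + m dot (fix_ i) dot (fix_ j) - m dot (fix_ i) dot dot
  - m dot dot dot (fix_ j) + m dot dot dot dot.

Definition d_of w (i j k l : 'I_N) : R :=
  let m := dotted w in
  w i j k l
  - m (fix_ i) dot dot dot - m dot (fix_ j) dot dot
  - m dot dot (fix_ k) dot - m dot dot dot (fix_ l)
  + m (fix_ i) (fix_ j) dot dot + m (fix_ i) dot (fix_ k) dot
  + m (fix_ i) dot dot (fix_ l) + m dot (fix_ j) (fix_ k) dot
  + m dot (fix_ j) dot (fix_ l) + m dot dot (fix_ k) (fix_ l)
  - m (fix_ i) (fix_ j) (fix_ k) dot - m (fix_ i) (fix_ j) dot (fix_ l)
  - m (fix_ i) dot (fix_ k) (fix_ l) - m dot (fix_ j) (fix_ k) (fix_ l)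
  + m dot dot dot dot.

Definition xi_of w (i k : 'I_N) : R :=
  let d := d_of w in
  d i i k k - N%:R^-1 * (\sum_k' d i i k' k') - N%:R^-1 * (\sum_i' d i' i' k k)
  + (N%:R ^+ 2)^-1 * (\sum_i' \sum_k' d i' i' k' k').

(* The maxima below are of nonnegative quantities, so starting from 0 is
   harmless. *)
Definition B_a w : R :=
  N%:R * \big[Num.max/0]_i \big[Num.max/0]_j `|a_of w i j|.

Definition V_a w : R := N%:R * \sum_i \sum_j a_of w i j ^+ 2.

Definition B_d w : R :=
  \big[Num.max/0]_(s : 'S_N)
    op_norm (\matrix_(i < N, j < N) d_of w i j (s i) (s j)).

Definition V_d w : R :=
  N%:R^-1 * (\sum_i \sum_k xi_of w i k ^+ 2)
  + (N%:R ^+ 2)^-1 *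
    (\sum_i \sum_(j | i != j) \sum_k \sum_(l | k != l) d_of w i j k l ^+ 2).

End DoublyIndexedStatistic.

(* [p] is a random permutation whose law is uniform on the symmetric group; the
   first conjunct is measurability of [p] for the discrete sigma-algebra. *)
Definition uniform_permutation (R : realType) (d : measure_display)
    (T : measurableType d) (P : probability T R) (N : nat) (p : T -> 'S_N) :
    Prop :=
  forall s : 'S_N,
    measurable (p @^-1` [set s]) /\ P (p @^-1` [set s]) = ((N`!)%:R^-1)%:E.

(* exp(- K t^2 / (V + B t)).  The quotient is taken in the extended reals, where
   the inverse of 0 is +oo: when V + B t = 0 the bound is exp(-oo) = 0, whereas
   the real quotient would be 0 and the bound 1. *)
Definition bernstein_bound (R : realType) (K V B t : R) : \bar R :=
  expeR (- ((K * t ^+ 2)%:E / (V + B * t)%:E))%E.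

(* Main.v *)
Require Import Defs.
From HB Require Import structures.
From mathcomp Require Import all_boot all_order all_algebra all_fingroup.
From mathcomp Require Import all_classical all_reals all_analysis.
From mathcomp Require Import ring lra zify.

(* The Hoeffding decomposition with respect to the four arguments of [w] gives
     Q w s - E (Q w) = N * sum_i a_w(i, s i) + (Q d_w s - E (Q d_w)),
   and each of the two statistics is shown to have a Bernstein-type moment
   generating function.

   Linear statistics.  Let [r], [t] be independent uniform permutations, and let
   [p], [p'] range over disjoint pairs of positions.  For a row-centred [b], the
   statistic [sum_i b(i, s i)] is, up to a factor, the conditional mean given
   [s = t o r^-1] of [sum_p (b(r p, t p) - b(r p, t p'))]. By Jensen's inequality
   it suffices to treat the latter sum, whose law is invariant under independent
   sign changes (exchange [t p] and [t p']); this leaves the exponential moment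
   of a sum of nonnegative terms [b(r p, t p) ^ 2], estimated by revealing the
   values [t p] one at a time.

   Degenerate quadratic statistics.  The same device with two families of pairs
   turns the off-diagonal part of [Q d] into a decoupled Rademacher chaos
     sum_(p, q) eps_p delta_q h_pq,
   up to a linear statistic and a remainder of order [B_d].  The matrix [h] is a
   sum of four submatrices of matrices [d(i, j, s i, s j)], so that its norm is at
   most [4 B_d]; the Hanson-Wright argument bounds the exponential moment by that
   of [sum h_pq ^ 2], to which the revealing argument is applied twice. *)

Set Implicit Arguments.
Unset Strict Implicit.
Unset Printing Implicit Defensive.

Import Order.TTheory GRing.Theory Num.Theory.

Local Open Scope ring_scope.

(** * Finite means over permutations *)

Section Exponential.
Variable R : realType.
Implicit Types x y z : R.

(** Inverting [1 - z <= exp (- z)] gives [exp z <= 1 / (1 - z)], and the polynomial times [1 - z]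
    exceeds 1 by [z ^ 2 (1 - 2 z)]. *)
Lemma expR_le_quad z : z <= 2^-1 -> expR z <= 1 + z + 2 * z ^+ 2.
Proof.
move=> hz; have h1 : 0 < 1 - z by lra.
have hN : 1 - z <= expR (- z) by exact: expR_ge1Dx.
rewrite -[z in expR z]opprK expRN.
have: (expR (- z))^-1 <= (1 - z)^-1 by rewrite lef_pV2 ?posrE ?expR_gt0.
move=> /le_trans; apply; rewrite -[leLHS]mul1r ler_pdivrMr // -subr_ge0.
have -> : (1 + z + 2 * z ^+ 2) * (1 - z) - 1 = z ^+ 2 * (1 - 2 * z) by ring.
by apply: mulr_ge0; [exact: sqr_ge0 | lra].
Qed.

Lemma expR_le_affine z : 0 <= z <= 2^-1 -> expR z <= 1 + 2 * z.
Proof.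
move=> /andP[z0 z1]; apply: (le_trans (expR_le_quad z1)).
by nra.
Qed.

(** For small [x] the linear terms of the two quadratic bounds cancel; otherwise [|x| <= 2 x ^ 2]
    bounds each exponential. *)
Lemma cosh_le_expR x : 2^-1 * (expR x + expR (- x)) <= expR (2 * x ^+ 2).
Proof.
have [hx|hx] := lerP `|x| 2^-1.
  have := ler_norml x 2^-1; rewrite hx => /esym/andP[h1 h2].
  have e1 : expR x <= 1 + x + 2 * x ^+ 2 by exact: expR_le_quad.
  have e2 : expR (- x) <= 1 + - x + 2 * (- x) ^+ 2 by apply: expR_le_quad; lra.
  apply: (@le_trans _ _ (1 + 2 * x ^+ 2)); last exact: expR_ge1Dx.
  by rewrite sqrrN in e2; lra.
have hle : `|x| <= 2 * x ^+ 2 by rewrite -(real_normK (num_real x)); nra.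
have e1 : expR x <= expR (2 * x ^+ 2).
  by rewrite ler_expR (le_trans (ler_norm x)).
have e2 : expR (- x) <= expR (2 * x ^+ 2).
  by rewrite ler_expR (le_trans _ hle)// -normrN ler_norm.
lra.
Qed.

(** Arithmetic-geometric mean inequality; it separates dependent summands in an exponent at the
    price of a factor 2. *)
Lemma expR_half x y :
  expR (x + y) <= 2^-1 * (expR (2 * x) + expR (2 * y)).
Proof.
have -> : 2 * x = x + x by ring.
have -> : 2 * y = y + y by ring.
rewrite !expRD; have := sqr_ge0 (expR x - expR y).
by nra.
Qed.

End Exponential.

Section FiniteMean.
Variable R : realType.

(** Expectation under the uniform law. On an empty type it is 0, hence the inhabitant [x0] in
    statements about constants. *)
Definition avg (T : finType) (f : T -> R) : R := #|T|%:R^-1 * \sum_x f x.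

Section OneType.
Variable T : finType.
Implicit Types f g : T -> R.

Lemma eq_avg f g : (forall x, f x = g x) -> avg f = avg g.
Proof. by move=> fg; rewrite /avg; congr (_ * _); apply: eq_bigr. Qed.

Lemma ler_avg f g : (forall x, f x <= g x) -> avg f <= avg g.
Proof.
by move=> fg; rewrite ler_wpM2l ?invr_ge0//; apply: ler_sum => x _; apply: fg.
Qed.

Lemma avgD f g : avg (fun x => f x + g x) = avg f + avg g.
Proof. by rewrite /avg big_split mulrDr. Qed.

Lemma avgZ c f : avg (fun x => c * f x) = c * avg f.
Proof. by rewrite /avg -mulr_sumr mulrCA. Qed.

Lemma avgN f : avg (fun x => - f x) = - avg f.
Proof. by rewrite /avg sumrN mulrN. Qed.

Lemma avgB f g : avg (fun x => f x - g x) = avg f - avg g.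
Proof. by rewrite avgD avgN. Qed.

Lemma avg_sum (I : Type) (r : seq I) (P : pred I) (F : I -> T -> R) :
  avg (fun x => \sum_(i <- r | P i) F i x) = \sum_(i <- r | P i) avg (F i).
Proof. by rewrite /avg exchange_big mulr_sumr. Qed.

Lemma avg_cst (x0 : T) c : avg (fun _ : T => c) = c.
Proof.
rewrite /avg sumr_const -[c *+ _]mulr_natr mulrCA mulVf ?mulr1// pnatr_eq0.
by rewrite -lt0n; apply/card_gt0P; exists x0.
Qed.

Lemma avg_le_cst (x0 : T) f c : (forall x, f x <= c) -> avg f <= c.
Proof. by move=> fc; rewrite -[leRHS](avg_cst x0); apply: ler_avg. Qed.

Lemma avg_reindex (h : T -> T) f : injective h -> avg (fun x => f (h x)) = avg f.
Proof. by move=> hI; rewrite /avg [in RHS](reindex_inj hI). Qed.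

(** Jensen's inequality: the tangent to the exponential at the mean [m] lies below the graph. *)
Lemma expR_avg (x0 : T) f : expR (avg f) <= avg (fun x => expR (f x)).
Proof.
set m := avg f.
have tangent x : expR m * (1 + (f x - m)) <= expR (f x).
  have -> : f x = m + (f x - m) by rewrite addrC subrK.
  rewrite expRD ler_wpM2l ?expR_ge0//.
  by rewrite [m + (f x - m)]addrC subrK; exact: expR_ge1Dx.
apply: (le_trans _ (ler_avg tangent)).
by rewrite avgZ avgD avgB !(avg_cst x0) subrr addr0 mulr1.
Qed.

End OneType.

Lemma exchange_avg (T U : finType) (F : T -> U -> R) :
  avg (fun x => avg (F x)) = avg (fun y => avg (F^~ y)).
Proof.
under eq_avg do rewrite /avg; rewrite avgZ [RHS]/avg -avg_sum.
by rewrite -/(avg _); congr (_ * _); apply: eq_avg.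
Qed.

End FiniteMean.

Section PermutationMean.
Variables (R : realType) (N : nat).
Implicit Types F : 'S_N -> R.

Lemma avg_mull (u : 'S_N) F : avg (fun s => F (u * s)%g) = avg F.
Proof. exact: avg_reindex (mulgI u). Qed.

(** As [tperm p r * s] sends [p] to [s r], the value at [p] is redrawn uniformly among the values of
    [s] on [D]; left translations preserve the uniform law. *)
Lemma avg_tperm (D : {set 'I_N}) (p : 'I_N) F : (0 < #|D|)%N ->
  avg F = avg (fun s => #|D|%:R^-1 * \sum_(r in D) F (tperm p r * s)%g).
Proof.
move=> D0; rewrite avgZ avg_sum.
under eq_bigr do rewrite avg_mull.
by rewrite sumr_const -[avg F *+ _]mulr_natr mulrCA mulVf ?mulr1// pnatr_eq0 -lt0n.
Qed.

(* The random points [s (al p)] are revealed one after the other: given the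
   others, the next one is uniform over at least half of the values. *)
Lemma avg_prod_peel (J : eqType) (al : J -> 'I_N) (C : {set 'I_N})
    (y : 'S_N -> J -> 'I_N -> R) (l : seq J) (G : 'S_N -> R) :
  {in l &, injective al} -> uniq l -> {in l, forall p, al p \notin C} ->
  (2 * (size l + #|C|) <= N)%N ->
  (forall s p k, 0 <= y s p k) -> (forall s, 0 <= G s) ->
  (forall a r s, a \notin C -> r \notin C -> y (tperm a r * s)%g = y s) ->
  (forall a r s, a \notin C -> r \notin C -> G (tperm a r * s)%g = G s) ->
  avg (fun s => G s * \prod_(p <- l) (1 + y s p (s (al p)))) <=
  avg (fun s => G s *
    \prod_(p <- l) (1 + 2 / N%:R * \sum_(r | r \notin C) y s p (s r))).
Proof.
move=> alI ul aC szl y0 G0 yinv Ginv.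
elim: l G alI ul aC szl G0 Ginv => [|a l IH] G alI ul aC szl G0 Ginv.
  by apply: ler_avg => s; rewrite !big_nil.
have [/negP alN ul'] : a \notin l /\ uniq l by move: ul => /=/andP[].
have aaC : al a \notin C by apply: aC; rewrite inE eqxx.
(* The positions that may be exchanged with [al a] without altering the other factors. They are at
   least half of all positions, whence the factor [2 / N]. *)
set D := [set r | r \notin C & all (fun p => r != al p) l].
have szD : (N <= 2 * #|D|)%N.
  have -> : D = ~: (C :|: [set r in map al l]).
    apply/setP => r; rewrite !inE negb_or; congr (_ && _).
    apply/allP/idP => [h|h p pl].
      by apply/mapP => -[p pl rp]; have := h p pl; rewrite rp eqxx.
    by apply: contra h => /eqP ->; exact: map_f.
  have h1 := cardsUI C [set r in map al l].
  have h2 : (#|[set r in map al l]| <= size l)%N.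
    by rewrite cardsE (leq_trans (card_size _)) ?size_map.
  have h3 := cardsC (C :|: [set r in map al l]); rewrite card_ord in h3.
  move: szl h1 h2 h3 => /=.
  set X := [set r in _]; move: #|C :&: X| #|~: (C :|: X)| #|C :|: X| #|X| #|C|.
  lia.
have N0 : (0 < N)%N by case: (al a) => ? ?; lia.
have D0 : (0 < #|D|)%N by lia.
have Dinv : #|D|%:R^-1 <= 2 / N%:R :> R.
  rewrite ler_pdivlMr ?ltr0n// mulrC ler_pdivrMr ?ltr0n//.
  by rewrite -natrM ler_nat.
(* The averaged factor of [a] joins the prefactor. Its sum runs over the whole complement of [C],
   which makes it invariant under transpositions outside [C]. *)
pose G' s : R := G s * (1 + 2 / N%:R * \sum_(r | r \notin C) y s a (s r)).
have fac0 s p : 0 <= 1 + 2 / N%:R * \sum_(r | r \notin C) y s p (s r).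
  by rewrite addr_ge0// mulr_ge0// ?mulr_ge0 ?invr_ge0// sumr_ge0.
rewrite (avg_tperm (al a) _ D0).
apply: (@le_trans _ _ (avg (fun s => G' s *
    \prod_(p <- l) (1 + y s p (s (al p)))))).
  apply: ler_avg => s.
  set P := \prod_(p <- l) _.
  have P0 : 0 <= P by apply: prodr_ge0 => p _; rewrite addr_ge0.
  have -> : \sum_(r in D) G (tperm (al a) r * s)%g *
      \prod_(p <- a :: l) (1 + y (tperm (al a) r * s)%g p
        ((tperm (al a) r * s)%g (al p))) =
      \sum_(r in D) (G s * P) * (1 + y s a (s r)).
    apply: eq_bigr => r; rewrite inE => /andP[rC /allP rl].
    rewrite Ginv// yinv// big_cons permM tpermL -mulrA; congr (_ * _).
    rewrite mulrC; congr (_ * _); rewrite /P !big_seq; apply: eq_bigr => p pl.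
    rewrite permM tpermD ?rl//; apply/eqP => e.
    by apply: alN; rewrite (alI a p) ?inE ?eqxx ?pl ?orbT.
  rewrite -mulr_sumr mulrCA /G' mulrAC; apply: ler_wpM2r => //; apply: ler_wpM2l => //.
  rewrite big_split /= sumr_const mulrDr -[1 *+ _]mulr_natr mul1r.
  rewrite mulVf ?pnatr_eq0 -?lt0n// lerD2l.
  apply: ler_pM => //; first by rewrite sumr_ge0.
  rewrite [leRHS](bigID (mem D)) /= [in leLHS]big_mkcond [X in X + _]big_mkcond /=.
  rewrite -[leLHS]addr0; apply: lerD; last by rewrite sumr_ge0.
  apply: ler_sum => r _; rewrite inE; case: (r \notin C) => //=.
have big_split_l s : G s * \prod_(p <- a :: l)
    (1 + 2 / N%:R * \sum_(r | r \notin C) y s p (s r)) =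
    G' s * \prod_(p <- l)
      (1 + 2 / N%:R * \sum_(r | r \notin C) y s p (s r)).
  by rewrite big_cons mulrA.
rewrite (eq_avg big_split_l); apply: IH => //.
- by move=> p q pl ql; apply: alI; rewrite inE ?pl ?ql orbT.
- by move=> p pl; apply: aC; rewrite inE pl orbT.
- by move: szl => /=; lia.
- by move=> s; rewrite mulr_ge0.
move=> b r s bC rC; rewrite /G' Ginv// yinv//; congr (_ * (1 + _ * _)).
rewrite [RHS](reindex_inj (@perm_inj _ (tperm b r))) /=.
apply: eq_big => [x|x _]; last by rewrite permM.
by case: tpermP => [->|->|//]; rewrite ?bC ?rC.
Qed.

End PermutationMean.

(** * Rademacher sums and chaoses *)

Section Rademacher.
Variable R : realType.

Definition sgn (I : finType) (e : {ffun I -> bool}) (i : I) : R := (-1) ^+ e i.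

(** The signs are independent, so that the mean is a product of hyperbolic cosines. *)
Lemma rademacher_linear (I : finType) (x : I -> R) :
  avg (fun e => expR (\sum_i sgn e i * x i)) <= expR (2 * \sum_i x i ^+ 2).
Proof.
have -> : avg (fun e => expR (\sum_i sgn e i * x i)) =
    \prod_i (2^-1 * (expR (x i) + expR (- x i))).
  rewrite big_split /= prodr_const /avg card_ffun card_bool natrX -exprVn.
  congr (_ * _).
  have h i : expR (x i) + expR (- x i) = \sum_b expR ((-1) ^+ nat_of_bool b * x i).
    by rewrite big_bool /= expr1 expr0 mulN1r mul1r addrC.
  under [RHS]eq_bigr do rewrite h.
  rewrite bigA_distr_bigA; apply: eq_bigr => e _.
  by rewrite expR_sum.
rewrite mulr_sumr expR_sum; apply: ler_prod => i _.
by rewrite cosh_le_expR mulr_ge0 ?invr_ge0 ?addr_ge0 ?expR_ge0.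
Qed.

Section QuadraticForm.
Variable I : finType.
Implicit Types (A : I -> I -> R) (s : seq I) (x : I -> R).

Definition qform A s x : R := \sum_(j <- s) \sum_(k <- s) A j k * (x j * x k).

Lemma qform_cons A i s x : (forall j k, A j k = A k j) ->
  qform A (i :: s) x =
  A i i * x i ^+ 2 + 2 * (x i * \sum_(k <- s) A i k * x k) + qform A s x.
Proof.
move=> Asym; rewrite /qform !big_cons.
under [X in _ + X]eq_bigr do rewrite big_cons.
rewrite big_split /= addrA; congr (_ + _).
have -> : \sum_(j <- s) A j i * (x j * x i) = x i * \sum_(k <- s) A i k * x k.
  by rewrite mulr_sumr; apply: eq_bigr => j _; rewrite Asym; ring.
have -> : \sum_(j <- s) A i j * (x i * x j) = x i * \sum_(k <- s) A i k * x k.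
  by rewrite mulr_sumr; apply: eq_bigr => j _; ring.
by ring.
Qed.

Lemma qform_rank1 A (a : I -> R) (c : R) s x :
  qform (fun j k => A j k + c * (a j * a k)) s x =
  qform A s x + c * (\sum_(k <- s) a k * x k) ^+ 2.
Proof.
rewrite /qform expr2 mulr_suml mulr_sumr -big_split; apply: eq_bigr => j _.
rewrite mulr_sumr mulr_sumr -big_split; apply: eq_bigr => k _ /=.
by ring.
Qed.

Lemma eq_qform A s x z : {in s, x =1 z} -> qform A s x = qform A s z.
Proof.
move=> xz; rewrite /qform !big_seq; apply: eq_bigr => j js.
by rewrite !big_seq; apply: eq_bigr => k ks; rewrite !xz.
Qed.

(** Pairing each sign pattern with the one that differs at [i] only isolates the average over a
    single sign. *)
Lemma avg_flip (i : I) (F : {ffun I -> bool} -> R) :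
  avg F = avg (fun e => 2^-1 * (F e + F [ffun j => (j == i) (+) e j])).
Proof.
rewrite avgZ avgD.
rewrite (@avg_reindex _ _ (fun e : {ffun I -> bool} => [ffun j => (j == i) (+) e j])).
  by lra.
move=> e e' /ffunP h; apply/ffunP => j; have := h j; rewrite !ffunE.
by move/addbI.
Qed.

(* Averaging over the sign of [x i] replaces [A] by a rank-one perturbation of
   its restriction, which stays below the same bound because it is dominated by
   a Schur complement; the trace grows by at most half of the removed entry. *)
Lemma rademacher_quadratic s A : uniq s -> (forall j k, A j k = A k j) ->
  (forall x, 0 <= qform A s x <= 16^-1 * \sum_(i <- s) x i ^+ 2) ->
  avg (fun e => expR (qform A s (sgn e))) <= expR (2 * \sum_(i <- s) A i i).
Proof.
elim: s A => [|i s IH] A us Asym Abnd.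
  rewrite (avg_le_cst [ffun=> false])// => e.
  by rewrite /qform !big_nil mulr0.
have /andP[iNs us'] := us.
(* Averaging [exp (2 x_i b)] over the sign [x_i] costs at most [exp (2 (2 b) ^ 2)], whence the
   coefficient 8. *)
pose A' j k := A j k + 8 * (A i j * A i k).
pose b x := \sum_(k <- s) A i k * x k.
have upd x (c : R) : let z j := if j == i then c else x j in
    [/\ z i = c, qform A s z = qform A s x, b z = b x &
        \sum_(j <- s) z j ^+ 2 = \sum_(j <- s) x j ^+ 2].
  have zx : {in s, (fun j => if j == i then c else x j) =1 x}.
    by move=> j js; case: eqP => // ji; move: iNs; rewrite -ji js.
  split; first by rewrite eqxx.
  - exact: eq_qform.
  - by rewrite /b !big_seq; apply: eq_bigr => j js; rewrite zx.
  - by rewrite !big_seq; apply: eq_bigr => j js; rewrite zx.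
have bnd x (c : R) : 0 <= A i i * c ^+ 2 + 2 * (c * b x) + qform A s x <=
    16^-1 * (c ^+ 2 + \sum_(j <- s) x j ^+ 2).
  have := Abnd (fun j => if j == i then c else x j).
  have [zi zq zb zs] := upd x c.
  by rewrite qform_cons// big_cons -/(b _) zs zq zb zi.
have A'E x : qform A' s x = qform A s x + 8 * b x ^+ 2 by exact: qform_rank1.
have Aii : 0 <= A i i.
  have /andP[h _] := bnd (fun=> 0) 1.
  have b0 : b (fun=> 0) = 0 by rewrite /b big1// => k _; rewrite mulr0.
  have q0 : qform A s (fun=> 0) = 0.
    by rewrite /qform big1// => j _; rewrite big1// => k _; rewrite !mulr0.
  by move: h; rewrite b0 q0; lra.
(* The lower bound is used at the vector with coordinate 1 at [i] and [- 16 A i k] at [k], the upper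
   bound at the same vector with coordinate 0 at [i]. *)
have bb : 16 * \sum_(k <- s) A i k ^+ 2 <= A i i.
  have bE : b (fun k => - 16 * A i k) = - 16 * \sum_(k <- s) A i k ^+ 2.
    by rewrite /b mulr_sumr; apply: eq_bigr => k _; ring.
  have sE : \sum_(j <- s) (- 16 * A i j) ^+ 2 = 256 * \sum_(k <- s) A i k ^+ 2.
    by rewrite mulr_sumr; apply: eq_bigr => k _; ring.
  have /andP[h1 _] := bnd (fun k => - 16 * A i k) 1.
  have /andP[_ h2] := bnd (fun k => - 16 * A i k) 0.
  by move: h1 h2; rewrite bE sE; lra.
have A'bnd x : 0 <= qform A' s x <= 16^-1 * \sum_(j <- s) x j ^+ 2.
  rewrite A'E; apply/andP; split.
    by have /andP[h _] := bnd x 0; have := sqr_ge0 (b x); lra.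
  (* The choice [c = 16 b x] maximizes [2 c b x - c ^ 2 / 16]. *)
  have /andP[_ h] := bnd x (16 * b x).
  have := mulr_ge0 Aii (sqr_ge0 (16 * b x)).
  by have := sqr_ge0 (b x); nra.
rewrite (avg_flip i).
apply: (@le_trans _ _ (avg (fun e => expR (A i i) * expR (qform A' s (sgn e))))).
  apply: ler_avg => e; set e' := [ffun j => _].
  have e's : {in s, sgn e' =1 sgn e}.
    move=> j js; rewrite /sgn ffunE; case: eqP => // ji.
    by move: iNs; rewrite -ji js.
  have e'i : sgn e' i = - sgn e i.
    by rewrite /sgn ffunE eqxx; case: (e i); rewrite /= ?expr1 ?expr0 ?opprK.
  have sq : sgn e i ^+ 2 = 1 by rewrite /sgn; case: (e i); rewrite /=; ring.
  rewrite !qform_cons// e'i sqrrN sq mulr1 (eq_qform _ e's).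
  have -> : \sum_(k <- s) A i k * sgn e' k = b (sgn e).
    by rewrite /b !big_seq; apply: eq_bigr => j js; rewrite e's.
  rewrite -/(b _) A'E -expRD.
  set c := 2 * (sgn e i * b (sgn e)).
  have -> : 2 * (- sgn e i * b (sgn e)) = - c by rewrite /c; ring.
  have eD (x : R) : expR (A i i + x + qform A s (sgn e)) =
      expR (A i i + qform A s (sgn e)) * expR x by rewrite -expRD addrAC.
  rewrite (eD c) (eD (- c)) addrA [leRHS]expRD -mulrDr mulrCA.
  apply: ler_wpM2l; first exact: expR_ge0.
  apply: (le_trans (cosh_le_expR c)); rewrite ler_expR /c.
  have -> : 2 * (2 * (sgn e i * b (sgn e))) ^+ 2 =
    8 * (sgn e i ^+ 2 * b (sgn e) ^+ 2) by ring.
  by rewrite sq mul1r.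
rewrite avgZ; apply: (@le_trans _ _ (expR (A i i) * expR (2 * \sum_(j <- s) A' j j))).
  rewrite ler_wpM2l ?expR_ge0// IH// => j k.
  by rewrite /A' Asym [A i j * _]mulrC.
rewrite -expRD ler_expR big_cons /A' big_split /= -mulr_sumr.
under [X in 8 * X]eq_bigr do rewrite -expr2.
by lra.
Qed.

End QuadraticForm.

(** Given the signs [e], the chaos is linear in [f]. Averaging over [f] leaves the quadratic form of
    [A = 2 h h^T] in [e], bounded by [2 / 32 = 1 / 16] and of trace [2 sum h ^ 2]. *)
Lemma rademacher_chaos (I J : finType) (h : I -> J -> R) :
  (forall x : I -> R,
    \sum_q (\sum_p x p * h p q) ^+ 2 <= 32^-1 * \sum_p x p ^+ 2) ->
  avg (fun e => avg (fun f =>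
    expR (\sum_p \sum_q sgn e p * sgn f q * h p q))) <=
  expR (4 * \sum_p \sum_q h p q ^+ 2).
Proof.
move=> hbnd; pose A p p' : R := 2 * \sum_q h p q * h p' q.
have AE x : qform A (index_enum I) x = 2 * \sum_q (\sum_p x p * h p q) ^+ 2.
  rewrite /qform.
  under eq_bigr do under eq_bigr do rewrite /A -mulrA mulr_suml mulr_sumr.
  under eq_bigr do rewrite exchange_big.
  rewrite exchange_big mulr_sumr; apply: eq_bigr => q _.
  rewrite expr2 mulr_suml mulr_sumr; apply: eq_bigr => p _.
  by rewrite !mulr_sumr; apply: eq_bigr => p' _; ring.
apply: (@le_trans _ _ (avg (fun e => expR (qform A (index_enum I) (sgn e))))).
  apply: ler_avg => e; rewrite AE.
  apply: (le_trans _ (rademacher_linear _)); apply: ler_avg => f.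
  rewrite ler_expR exchange_big; apply: ler_sum => q _.
  by rewrite mulr_sumr; apply: ler_sum => p _; rewrite mulrCA mulrA.
apply: (le_trans (rademacher_quadratic (index_enum_uniq _) _ _)).
- by move=> j k; rewrite /A; congr (_ * _); apply: eq_bigr => q _; rewrite mulrC.
- move=> x; rewrite AE; apply/andP; split.
    by rewrite mulr_ge0// sumr_ge0// => q _; rewrite sqr_ge0.
  by have := hbnd x; lra.
rewrite ler_expR mulr_sumr mulr_sumr; apply: ler_sum => p _.
rewrite /A mulrA -natrM; under eq_bigr do rewrite -expr2.
exact: lexx.
Qed.

End Rademacher.

(** * The spectral norm *)

Section SpectralNorm.
Variable R : realType.

Lemma euclidean_norm_sqr n (x : 'cV[R]_n) :
  euclidean_norm x ^+ 2 = \sum_i x i 0 ^+ 2.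
Proof. by rewrite sqr_sqrtr// sumr_ge0// => i _; rewrite sqr_ge0. Qed.

Lemma euclidean_normZ n c (x : 'cV[R]_n) :
  euclidean_norm (c *: x) = `|c| * euclidean_norm x.
Proof.
rewrite -sqrtr_sqr -sqrtrM ?sqr_ge0//; congr (Num.sqrt _).
by rewrite mulr_sumr; apply: eq_bigr => i _; rewrite mxE exprMn.
Qed.

Lemma op_norm_ub n (A : 'M[R]_n) (x : 'cV[R]_n) :
  euclidean_norm x <= 1 -> euclidean_norm (A *m x) <= op_norm A.
Proof.
move=> x1; apply: sup_upper_bound; last by exists x.
split.
  exists (euclidean_norm (A *m 0)); exists 0 => //=.
  rewrite /euclidean_norm big1 ?sqrtr0// => i _.
  by rewrite mxE expr0n.
(* A crude bound by absolute row sums; it only serves to show that the supremum is that of a bounded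
   set. *)
exists (Num.sqrt (\sum_i (\sum_j `|A i j|) ^+ 2)) => _ [z /= z1 <-].
apply: ler_wsqrtr; apply: ler_sum => i _.
have zj j : `|z j 0| <= 1.
  rewrite -(@expr_le1 _ 2)// real_normK ?num_real//.
  apply: (@le_trans _ _ (euclidean_norm z ^+ 2)); last first.
    by rewrite expr_le1// sqrtr_ge0.
  rewrite euclidean_norm_sqr (bigD1 j)//= lerDl sumr_ge0// => k _.
  exact: sqr_ge0.
rewrite -[leLHS]real_normK ?num_real// lerXn2r ?nnegrE ?sumr_ge0//.
rewrite mxE (le_trans (ler_norm_sum _ _ _))//; apply: ler_sum => j _.
by rewrite normrM ler_piMr.
Qed.

Lemma op_norm_ge0 n (A : 'M[R]_n) : 0 <= op_norm A.
Proof.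
apply: (le_trans (sqrtr_ge0 _)); apply: (@op_norm_ub _ A 0).
rewrite /euclidean_norm big1 ?sqrtr0// => i _.
by rewrite mxE expr0n.
Qed.

(** Homogeneity carries the bound from the unit ball to all vectors; the squared form avoids square
    roots later. *)
Lemma op_normP n (A : 'M[R]_n) (v : 'I_n -> R) :
  \sum_i (\sum_j A i j * v j) ^+ 2 <= op_norm A ^+ 2 * \sum_j v j ^+ 2.
Proof.
pose x : 'cV[R]_n := \col_j v j.
have -> : \sum_j v j ^+ 2 = euclidean_norm x ^+ 2.
  by rewrite euclidean_norm_sqr; apply: eq_bigr => j _; rewrite mxE.
have -> : \sum_i (\sum_j A i j * v j) ^+ 2 = euclidean_norm (A *m x) ^+ 2.
  rewrite euclidean_norm_sqr; apply: eq_bigr => i _; rewrite mxE.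
  by congr (_ ^+ 2); apply: eq_bigr => j _; rewrite mxE.
rewrite -exprMn lerXn2r ?nnegrE ?mulr_ge0 ?sqrtr_ge0 ?op_norm_ge0//.
have [x0|xn0] := eqVneq (euclidean_norm x) 0.
  have -> : x = 0.
    apply/matrixP => i j; rewrite !ord1 [RHS]mxE; apply/eqP.
    have := euclidean_norm_sqr x; rewrite x0 expr0n /= => /esym/eqP.
    rewrite psumr_eq0 => [/allP/(_ i)|k _]; last exact: sqr_ge0.
    by rewrite mem_index_enum sqrf_eq0 => /(_ isT).
  by rewrite mulmx0 -(scale0r (0 : 'cV[R]_n)) !euclidean_normZ normr0 !mul0r mulr0.
have xp : 0 < euclidean_norm x by rewrite lt0r xn0 sqrtr_ge0.
have h : euclidean_norm (A *m ((euclidean_norm x)^-1 *: x)) <= op_norm A.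
  by apply: op_norm_ub; rewrite euclidean_normZ gtr0_norm ?invr_gt0// mulVf.
move: h; rewrite -scalemxAr euclidean_normZ gtr0_norm ?invr_gt0//.
by rewrite mulrC ler_pdivrMr.
Qed.

End SpectralNorm.

Lemma ler_sum_inj (R : numDomainType) (I J : finType) (g : J -> I) (F : I -> R) :
  injective g -> (forall i, 0 <= F i) -> \sum_q F (g q) <= \sum_i F i.
Proof.
move=> gI F0; have -> : \sum_q F (g q) = \sum_(i in [set g q | q : J]) F i.
  by rewrite big_imset//= => p q _ _; exact: gI.
rewrite [leRHS](bigID (mem [set g q | q : J])) /= lerDl.
exact: sumr_ge0.
Qed.

Section OpBounded.
Variables (R : realType) (N : nat).
Variable d : 'I_N -> 'I_N -> 'I_N -> 'I_N -> R.
Variable B : R.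

(** For [B >= 0], a spectral norm bound on the matrices [d(i, j, s i, s j)], uniform in the
    permutation. *)
Definition op_bounded := forall (s : 'S_N) (v : 'I_N -> R),
  \sum_i (\sum_j d i j (s i) (s j) * v j) ^+ 2 <= B ^+ 2 * \sum_j v j ^+ 2.

Hypothesis dB : op_bounded.

(** With [M] the matrix and [w = M^T u], one has [|w| ^ 2 = <u, M w>], and a weighted
    arithmetic-geometric mean inequality absorbs half of [|w| ^ 2]. If [B = 0] then [M w = 0]. *)
Lemma op_bounded_tr (s : 'S_N) (u : 'I_N -> R) :
  \sum_j (\sum_i u i * d i j (s i) (s j)) ^+ 2 <= B ^+ 2 * \sum_i u i ^+ 2.
Proof.
pose w j := \sum_i u i * d i j (s i) (s j).
pose z i := \sum_j d i j (s i) (s j) * w j.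
rewrite -/(w _); set W := \sum_j w j ^+ 2; set U := \sum_i u i ^+ 2.
have W0 : 0 <= W by apply: sumr_ge0 => j _; rewrite sqr_ge0.
have zW : \sum_i z i ^+ 2 <= B ^+ 2 * W by exact: dB.
have WE : W = \sum_i u i * z i.
  under [RHS]eq_bigr do rewrite mulr_sumr.
  rewrite exchange_big; apply: eq_bigr => j _; rewrite expr2 {1}/w mulr_suml.
  by apply: eq_bigr => i _; rewrite mulrA.
have cs : W <= B ^+ 2 * U / 2 + W / 2 \/ B = 0.
  have [->|Bn0] := eqVneq B 0; [by right | left].
  have h : W <= \sum_i (2^-1 * (B ^+ 2 * u i ^+ 2) + 2^-1 * (B ^- 2 * z i ^+ 2)).
    rewrite WE; apply: ler_sum => i _.
    have -> : u i * z i = (B * u i) * (B^-1 * z i).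
      by rewrite mulrACA mulfV// mul1r.
    by rewrite -exprVn -!exprMn; have := sqr_ge0 (B * u i - B^-1 * z i); lra.
  rewrite big_split /= -!mulr_sumr -/U in h.
  have h2 : B ^- 2 * \sum_i z i ^+ 2 <= W.
    by rewrite mulrC ler_pdivrMr ?exprn_even_gt0// mulrC.
  lra.
case: cs => [|B0]; first by lra.
have z0 i : z i = 0.
  have : \sum_i z i ^+ 2 == 0.
    rewrite eq_le sumr_ge0 ?andbT => [|k _]; last exact: sqr_ge0.
    by apply: (le_trans zW); rewrite B0 expr0n mul0r.
  rewrite psumr_eq0 => [/allP/(_ i)|k _]; last exact: sqr_ge0.
  by rewrite mem_index_enum sqrf_eq0 => /(_ isT) /eqP.
rewrite WE big1 => [|i _]; last by rewrite z0 mulr0.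
by apply: mulr_ge0; [exact: sqr_ge0 | apply: sumr_ge0 => i _; exact: sqr_ge0].
Qed.

(** The vector is extended by zero along [f], and the columns outside the image of [g] are
    dropped. *)
Lemma op_bounded_block (s : 'S_N) (J : finType) (f g : J -> 'I_N) (x : J -> R) :
  injective f -> injective g ->
  \sum_q (\sum_p x p * d (f p) (g q) (s (f p)) (s (g q))) ^+ 2 <=
  B ^+ 2 * \sum_p x p ^+ 2.
Proof.
move=> fI gI; pose u i := \sum_(p | f p == i) x p.
have uf p : u (f p) = x p.
  rewrite /u (bigD1 p)//= big1 ?addr0// => q /andP[/eqP/fI -> ].
  by rewrite eqxx.
have pushf (F : 'I_N -> R) : \sum_i u i * F i = \sum_p x p * F (f p).
  rewrite [RHS](partition_big f xpredT)//=; apply: eq_bigr => i _.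
  by rewrite mulr_suml; apply: eq_bigr => p /eqP ->.
have u2 : \sum_i u i ^+ 2 = \sum_p x p ^+ 2.
  by under eq_bigr do rewrite expr2; rewrite pushf; apply: eq_bigr => p _; rewrite uf.
rewrite -u2; apply: (le_trans _ (op_bounded_tr s u)).
apply: (le_trans _ (ler_sum_inj gI _)) => [|j]; last exact: sqr_ge0.
by apply: ler_sum => q _; rewrite pushf.
Qed.

Lemma op_bounded_col (s : 'S_N) j : \sum_i d i j (s i) (s j) ^+ 2 <= B ^+ 2.
Proof.
have := dB s (fun k => (k == j)%:R).
rewrite [X in _ * X](bigD1 j)//= eqxx [X in _ * (_ + X)]big1 => [|k /negbTE ->]; last by rewrite expr0n.
rewrite expr1n addr0 mulr1; apply: le_trans; apply: ler_sum => i _.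
rewrite (bigD1 j)//= eqxx big1 => [|k /negbTE ->]; last by rewrite mulr0.
by rewrite mulr1 addr0.
Qed.

Lemma op_bounded_row (s : 'S_N) i : \sum_j d i j (s i) (s j) ^+ 2 <= B ^+ 2.
Proof.
have := op_bounded_tr s (fun k => (k == i)%:R).
rewrite [X in _ * X](bigD1 i)//= eqxx [X in _ * (_ + X)]big1 => [|k /negbTE ->]; last by rewrite expr0n.
rewrite expr1n addr0 mulr1; apply: le_trans; apply: ler_sum => j _.
rewrite (bigD1 i)//= eqxx big1 => [|k /negbTE ->]; last by rewrite mul0r.
by rewrite mul1r addr0.
Qed.

Lemma op_bounded_entry (s : 'S_N) i j : 0 <= B -> `|d i j (s i) (s j)| <= B.
Proof.
move=> B0; rewrite -(@ler_pXn2r _ 2) ?nnegrE// real_normK ?num_real//.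
apply: le_trans (op_bounded_row s i).
by rewrite [leRHS](bigD1 j)//= lerDl sumr_ge0// => k _; rewrite sqr_ge0.
Qed.

End OpBounded.

Lemma op_bounded_d_of (R : realType) N (w : 'I_N -> 'I_N -> 'I_N -> 'I_N -> R) :
  op_bounded (d_of w) (B_d w).
Proof.
move=> s v; set A : 'M[R]_N := \matrix_(i, j) d_of w i j (s i) (s j).
have AB : op_norm A <= B_d w by apply: (le_bigmax_cond _ (fun _ => _)).
have -> : \sum_i (\sum_j d_of w i j (s i) (s j) * v j) ^+ 2 =
    \sum_i (\sum_j A i j * v j) ^+ 2.
  by apply: eq_bigr => i _; congr (_ ^+ 2); apply: eq_bigr => j _; rewrite mxE.
apply: (le_trans (op_normP _ _)); rewrite ler_wpM2r//.
  by rewrite sumr_ge0// => j _; rewrite sqr_ge0.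
by rewrite lerXn2r ?nnegrE ?op_norm_ge0// (le_trans (op_norm_ge0 A)).
Qed.

(** * Symmetrization *)

Section Symmetrization.
Variables (R : realType) (N : nat).

(** Composing the flips [t p] over the [p] with [e p] true realizes any sign pattern by a left
    translation. The index in [K] is carried along for the version with two families. *)
Lemma flips_signs (J : finType) (K : Type) (h : 'S_N -> J -> K -> R)
    (t : J -> 'S_N) :
  (forall s p p' k, h (t p * s)%g p' k = if p' == p then - h s p' k else h s p' k) ->
  forall e : {ffun J -> bool}, exists u : 'S_N,
    forall s p k, h (u * s)%g p k = sgn R e p * h s p k.
Proof.
move=> ht e.
have [u hu] : exists u : 'S_N, forall s p k, h (u * s)%g p k =
    (if p \in index_enum J then sgn R e p else 1) * h s p k.
  elim: (index_enum J) (index_enum_uniq J) => [_|a l IH /=/andP[al ul]].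
    by exists 1%g => s p k; rewrite mul1g mul1r.
  have [u hu] := IH ul.
  exists ((if e a then t a else 1) * u)%g => s p k; rewrite -mulgA inE.
  have -> : h ((if e a then t a else 1) * (u * s))%g p k =
      (if (p == a) && e a then -1 else 1) * h (u * s)%g p k.
    case: (e a); last by rewrite mul1g andbF mul1r.
    by rewrite ht andbT; case: eqP; rewrite ?mulN1r ?mul1r.
  rewrite hu mulrA; congr (_ * _); have [->|] := eqVneq p a; last by rewrite mul1r.
  by rewrite (negbTE al) mulr1 /sgn; case: (e a).
by exists u => s p k; rewrite hu mem_index_enum.
Qed.

(** Translation invariance inserts independent signs; given [s], a Rademacher sum remains. *)
Lemma avg_expR_flips (J : finType) (h : 'S_N -> J -> R) (t : J -> 'S_N) :
  (forall s p p', h (t p * s)%g p' = if p' == p then - h s p' else h s p') ->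
  avg (fun s => expR (\sum_p h s p)) <=
  avg (fun s => expR (2 * \sum_p h s p ^+ 2)).
Proof.
move=> ht; pose h' s p (_ : unit) := h s p.
have h't s p p' k : h' (t p * s)%g p' k = if p' == p then - h' s p' k else h' s p' k.
  exact: ht.
have -> : avg (fun s => expR (\sum_p h s p)) =
    avg (fun e => avg (fun s => expR (\sum_p sgn R e p * h s p))).
  rewrite -[LHS](avg_cst ([ffun=> false] : {ffun J -> bool})).
  apply: eq_avg => e; have [u hu] := flips_signs h't e.
  rewrite -(avg_mull u); apply: eq_avg => s; congr expR.
  by apply: eq_bigr => p _; exact: (hu s p tt).
rewrite exchange_avg; apply: ler_avg => s; exact: rademacher_linear.
Qed.

(** Each family of flips inserts its own independent signs; given [s], a decoupled chaos remains. *)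
Lemma avg_expR_flips2 (J K : finType) (h : 'S_N -> J -> K -> R)
    (t : J -> 'S_N) (v : K -> 'S_N) :
  (forall s p p' q, h (t p * s)%g p' q = if p' == p then - h s p' q else h s p' q) ->
  (forall s p q q', h (v q * s)%g p q' = if q' == q then - h s p q' else h s p q') ->
  (forall s (x : J -> R),
    \sum_q (\sum_p x p * h s p q) ^+ 2 <= 32^-1 * \sum_p x p ^+ 2) ->
  avg (fun s => expR (\sum_p \sum_q h s p q)) <=
  avg (fun s => expR (4 * \sum_p \sum_q h s p q ^+ 2)).
Proof.
move=> ht hv hbnd; pose h' s q p := h s p q.
have h'v s q q' p : h' (v q * s)%g q' p = if q' == q then - h' s q' p else h' s q' p.
  exact: hv.
have -> : avg (fun s => expR (\sum_p \sum_q h s p q)) =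
    avg (fun s => avg (fun e => avg (fun f =>
      expR (\sum_p \sum_q sgn R e p * sgn R f q * h s p q)))).
  rewrite -[RHS]exchange_avg.
  rewrite -[LHS](avg_cst ([ffun=> false] : {ffun J -> bool})).
  apply: eq_avg => e; rewrite -[RHS]exchange_avg.
  rewrite -[LHS](avg_cst ([ffun=> false] : {ffun K -> bool})).
  apply: eq_avg => f.
  have [u hu] := flips_signs ht e; have [u' hu'] := flips_signs h'v f.
  rewrite -(avg_mull (u * u')); apply: eq_avg => s; congr expR.
  apply: eq_bigr => p _; apply: eq_bigr => q _.
  by rewrite -mulgA hu -mulrA; congr (_ * _); exact: (hu' s q p).
by apply: ler_avg => s; exact: rademacher_chaos.
Qed.

(** The bound [exp z <= 1 + 2 z] produces a product to which revealing applies, and [1 + x <= exp x]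
    leads back. The terms [z s] may depend on [s] only through its values on [C]. *)
Lemma avg_expR_peel (J : finType) (al : J -> 'I_N) (C : {set 'I_N})
    (z : 'S_N -> J -> 'I_N -> R) :
  injective al -> (forall p, al p \notin C) ->
  (2 * (#|J| + #|C|) <= N)%N ->
  (forall s p k, 0 <= z s p k) -> (forall s p, z s p (s (al p)) <= 2^-1) ->
  (forall a r s, a \notin C -> r \notin C -> z (tperm a r * s)%g = z s) ->
  avg (fun s => expR (\sum_p z s p (s (al p)))) <=
  avg (fun s => expR (4 / N%:R * \sum_p \sum_(r | r \notin C) z s p (s r))).
Proof.
move=> alI alC szJ z0 z1 zinv.
pose y s p k := 2 * z s p k.
have := @avg_prod_peel R N J al C y (index_enum J) (fun=> 1).
move=> /(_ (in2W alI) (index_enum_uniq _)) peel.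
apply: (@le_trans _ _ (avg (fun s => 1 * \prod_(p : J) (1 + y s p (s (al p)))))).
  apply: ler_avg => s; rewrite mul1r expR_sum; apply: ler_prod => p _.
  by rewrite expR_ge0 expR_le_affine// z0 z1.
apply: (le_trans (peel _ _ _ _ _ _)) => //.
- by rewrite -sum1_size sum1_card.
- by move=> s p k; rewrite mulr_ge0.
- by move=> a r s aC rC; rewrite /y zinv.
apply: ler_avg => s; rewrite mul1r mulr_sumr expR_sum; apply: ler_prod => p _.
have -> : 4 / N%:R * \sum_(r | r \notin C) z s p (s r) =
    2 / N%:R * \sum_(r | r \notin C) y s p (s r).
  by rewrite -mulr_sumr mulrA [_ * 2]mulrAC -natrM.
rewrite expR_ge1Dx andbT addr_ge0// mulr_ge0 ?mulr_ge0 ?invr_ge0// sumr_ge0// => r _.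
by rewrite mulr_ge0.
Qed.

(* Jensen's inequality for the mean over [r], followed by the change of variables
   [t = r * s], which makes [r] and [t] independent. *)
Lemma avg_expR_decouple (X : 'S_N -> 'S_N -> R) (c : R) :
  (forall r, avg (fun t => expR (X r t)) <= c) ->
  avg (fun s => expR (avg (fun r => X r (r * s)%g))) <= c.
Proof.
move=> Xc.
apply: (@le_trans _ _ (avg (fun s => avg (fun r => expR (X r (r * s)%g))))).
  by apply: ler_avg => s; exact: (expR_avg 1%g).
rewrite exchange_avg; apply: (avg_le_cst 1%g) => r.
by rewrite (avg_mull r (fun t => expR (X r t))).
Qed.

Lemma avg_perm1 (a : 'I_N) (f : 'I_N -> R) :
  avg (fun r : 'S_N => f (r a)) = N%:R^-1 * \sum_x f x.
Proof.
have T0 : (0 < #|[set: 'I_N]|)%N by rewrite cardsT card_ord; case: a => ? ?; lia.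
rewrite (avg_tperm a _ T0) -[RHS](avg_cst (1%g : 'S_N)); apply: eq_avg => s.
rewrite cardsT card_ord; congr (_ * _).
rewrite [RHS](reindex_inj (@perm_inj _ s)) big_mkcond; apply: eq_bigr => r _.
by rewrite inE permM tpermL.
Qed.

(** Given [r a], the value [r b] is uniform over the other [N - 1] points. *)
Lemma avg_perm2 (a b : 'I_N) (f : 'I_N -> 'I_N -> R) : a != b ->
  N%:R * (N%:R - 1) * avg (fun r : 'S_N => f (r a) (r b)) =
  \sum_x \sum_(y | y != x) f x y.
Proof.
move=> ab; have N2 : (1 < N)%N.
  by move: ab; rewrite -val_eqE; case: a b => [a ?] [b ?] /=; lia.
have cD : #|[set~ a]| = N.-1 by rewrite cardsC1 card_ord.
have D0 : (0 < #|[set~ a]|)%N by rewrite cD; lia.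
have NE : N%:R - 1 = N.-1%:R :> R by rewrite -subn1 natrB//; lia.
rewrite (avg_tperm b _ D0) avgZ cD NE -mulrA mulVKf ?pnatr_eq0; last by lia.
rewrite -[RHS](mulVKf (x := N%:R)) ?pnatr_eq0; last by lia.
congr (_ * _); rewrite -(avg_perm1 a); apply: eq_avg => s.
rewrite [RHS](reindex_inj (@perm_inj _ s)); apply: eq_big => r.
  by rewrite !inE (inj_eq perm_inj).
by rewrite !inE => ra; rewrite !permM tpermL tpermD// eq_sym.
Qed.

End Symmetrization.

(** * Four disjoint blocks of positions *)

Section Blocks.
Variable N : nat.

Lemma blk_subproof (k : 'I_4) (p : 'I_(N %/ 4)) : (k * (N %/ 4) + p < N)%N.
Proof. by case: k p => [k ?] [p ?] /=; nia. Qed.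

Definition blk k p : 'I_N := Ordinal (blk_subproof k p).

Lemma blk_eq k k' p p' : (blk k p == blk k' p') = (k == k') && (p == p').
Proof.
apply/eqP/andP => [/(congr1 val) /= e|[/eqP -> /eqP ->]//].
rewrite -!val_eqE /=.
have n0 : (0 < N %/ 4)%N by case: p {e} => p ?; lia.
have /eqP := congr1 (fun m => m %/ (N %/ 4))%N e.
have /eqP := congr1 (fun m => m %% (N %/ 4))%N e.
by rewrite !modnMDl !modn_small// !divnMDl// !(divn_small (ltn_ord _)) !addn0 => -> ->.
Qed.

Lemma blk_inj k : injective (blk k).
Proof. by move=> p p' /eqP; rewrite blk_eq eqxx => /eqP. Qed.

(** A product of disjoint transpositions, built one position at a time; it later identifies the four
    kinds of entries of a mixed difference. *)
Lemma swap_blk (k k' : 'I_4) : k != k' -> exists u : 'S_N,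
  (forall p, u (blk k p) = blk k' p) /\
  (forall k'' p, k'' != k -> k'' != k' -> u (blk k'' p) = blk k'' p).
Proof.
move=> kk'.
have [u [u1 u2]] : exists u : 'S_N,
    {in index_enum 'I_(N %/ 4), forall p, u (blk k p) = blk k' p} /\
    (forall k'' p, (k'' != k) && (k'' != k') || (p \notin index_enum 'I_(N %/ 4)) ->
      u (blk k'' p) = blk k'' p).
  elim: (index_enum _) (index_enum_uniq 'I_(N %/ 4)) => [_|a l IH /=/andP[al ul]].
    by exists 1%g; split=> // *; rewrite perm1.
  have [u [u1 u2]] := IH ul; exists (u * tperm (blk k a) (blk k' a))%g; split.
    move=> p; rewrite inE permM; case: eqVneq => [->|pa] /= pl.
      by rewrite u2 ?al ?orbT// tpermL.
    by rewrite u1// tpermD// blk_eq ?(negbTE kk') //= eqxx /= eq_sym.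
  move=> k'' p; rewrite inE negb_or permM => h.
  rewrite u2; last by case/orP: h => [->//|/andP[_ ->]]; rewrite orbT.
  rewrite tpermD// blk_eq ![_ == k'']eq_sym ![_ == p]eq_sym;
    by case/orP: h => /andP[/negbTE h1 /negbTE h2]; rewrite ?h1 ?h2 ?andbF.
exists u; split=> [p|k'' p h1 h2]; first by rewrite u1// mem_index_enum.
by rewrite u2// h1 h2.
Qed.

End Blocks.

(** * Exponential moments of linear statistics *)

Section LinearStatistic.
Variables (R : realType) (N : nat).
Hypothesis N20 : (20 <= N)%N.

Let n := (N %/ 4)%N.

(** [N <= 4 n + 3], and [n >= 5] absorbs the remainder. *)
Lemma natr_le5 : N%:R <= 5 * n%:R :> R.
Proof. by rewrite -natrM ler_nat /n; lia. Qed.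

(** With [C] empty the revealed sums are deterministic, since [s] merely permutes the values. *)
Lemma avg_expR_linear_pos (J : finType) (al : J -> 'I_N) (z : J -> 'I_N -> R) :
  injective al -> (2 * #|J| <= N)%N -> (forall p k, 0 <= z p k <= 2^-1) ->
  avg (fun s : 'S_N => expR (\sum_p z p (s (al p)))) <=
  expR (4 / N%:R * \sum_p \sum_k z p k).
Proof.
move=> alI szJ z01.
apply: (le_trans (@avg_expR_peel R N J al finset.set0 (fun=> z) _ _ _ _ _ _)) => //.
- by move=> p; rewrite inE.
- by rewrite cards0 addn0.
- by move=> s p k; have /andP[] := z01 p k.
- by move=> s p; have /andP[] := z01 p (s (al p)).
apply: (avg_le_cst 1%g) => s; rewrite le_eqVlt; apply/orP; left; apply/eqP.
congr (expR (_ * _)); apply: eq_bigr => p _.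
rewrite [RHS](reindex_inj (@perm_inj _ s)); apply: eq_bigl => r.
by rewrite inE.
Qed.

Definition linear_stat (b : 'I_N -> 'I_N -> R) (s : 'S_N) : R := \sum_i b i (s i).

(** The first term has mean [linear_stat b s / N]; by row centring, the second has mean minus this
    divided by [N - 1]. *)
Lemma linear_stat_diff (b : 'I_N -> 'I_N -> R) (s : 'S_N) (x y : 'I_N) :
  (forall i, \sum_k b i k = 0) -> x != y ->
  (N%:R - 1) * avg (fun r : 'S_N => b (r x) ((r * s)%g x) - b (r x) ((r * s)%g y)) =
  linear_stat b s.
Proof.
move=> b0 xy; have N0 : N%:R != 0 :> R by rewrite pnatr_eq0; lia.
have N1 : (N%:R - 1) != 0 :> R.
  by rewrite -[1]/(1%:R) -natrB ?pnatr_eq0; lia.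
rewrite (eq_avg (g := fun r : 'S_N => b (r x) (s (r x)) - b (r x) (s (r y)))); last first.
  by move=> r; rewrite !permM.
rewrite avgB.
rewrite (avg_perm1 x (fun i => b i (s i))) -/(linear_stat b s).
have := avg_perm2 (fun i j => b i (s j)) xy.
have -> : \sum_i \sum_(j | j != i) b i (s j) = - linear_stat b s.
  rewrite /linear_stat -sumrN; apply: eq_bigr => i _.
  have := b0 i; rewrite (reindex_inj (@perm_inj _ s)) (bigD1 i)//= => h.
  by apply/eqP; rewrite -addr_eq0 addrC h.
move=> /(canRL (mulKf (mulf_neq0 N0 N1))) ->.
by field; rewrite N0 N1.
Qed.

(** The smallness [1 / 20] keeps the revealed terms below [8 * 25 / 400 = 1 / 2]. In
    [800 = 4 * 8 * 25], 4 comes from revealing, 8 from symmetrization and 25 from [N <= 5 n]. *)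
Lemma linear_mgf (b : 'I_N -> 'I_N -> R) (M lam : R) :
  (forall i, \sum_k b i k = 0) -> (forall i k, `|b i k| <= M) ->
  `|lam| * M <= 20^-1 ->
  avg (fun s => expR (lam * linear_stat b s)) <=
  expR (800 * lam ^+ 2 * (N%:R^-1 * \sum_i \sum_k b i k ^+ 2)).
Proof.
move=> b0 bM lamM.
have Npos : 0 < N%:R :> R by rewrite ltr0n; lia.
have npos : 0 < n%:R :> R by rewrite ltr0n /n; lia.
pose al := @blk N 0; pose al' := @blk N 1.
(* Each of the [n] averaged differences is [linear_stat b s / (N - 1)]; this factor makes their sum
   [lam * linear_stat b s]. *)
pose c := lam * ((N%:R - 1) / n%:R).
have c2 : c ^+ 2 <= 25 * lam ^+ 2.
  rewrite /c exprMn mulrC ler_wpM2r ?sqr_ge0//.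
  have h : (0 : R) <= (N%:R - 1) / n%:R <= (5 : R).
    apply/andP; split.
      by apply: divr_ge0; rewrite ?subr_ge0 ?ler1n//; lia.
    by rewrite ler_pdivrMr//; have := natr_le5; lra.
  by nra.
have cb i k : 8 * c ^+ 2 * b i k ^+ 2 <= 2^-1.
  have h1 : b i k ^+ 2 <= M ^+ 2.
    rewrite -real_normK ?num_real// lerXn2r ?nnegrE//.
    exact: le_trans (normr_ge0 _) (bM i k).
  have h2 : lam ^+ 2 * M ^+ 2 <= 400^-1.
    have M0 : 0 <= M by exact: le_trans (normr_ge0 _) (bM i k).
    rewrite -[lam ^+ 2]real_normK ?num_real// -exprMn.
    have : 0 <= `|lam| * M by rewrite mulr_ge0.
    by nra.
  have := ler_wpM2l (sqr_ge0 c) h1.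
  have := ler_wpM2r (sqr_ge0 M) c2.
  lra.
pose h (r t : 'S_N) p := c * (b (r (al p)) (t (al p)) - b (r (al p)) (t (al' p))).
have statE s : lam * linear_stat b s = avg (fun r => \sum_p h r (r * s)%g p).
  rewrite avg_sum.
  have hE p : avg (fun r => h r (r * s)%g p) = lam / n%:R * linear_stat b s.
    rewrite /h avgZ -(@linear_stat_diff b s (al p) (al' p))//; last by rewrite blk_eq.
    by rewrite /c; field; rewrite gt_eqF.
  under eq_bigr do rewrite hE.
  rewrite sumr_const card_ord -[_ *+ _]mulr_natr.
  by rewrite mulrAC mulfVK ?gt_eqF.
under eq_avg do rewrite statE.
apply: (avg_expR_decouple (X := fun r t => \sum_p h r t p)) => r.
pose t p := tperm (al p) (al' p).
have ht s p p' : h r (t p * s)%g p' = if p' == p then - h r s p' else h r s p'.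
  rewrite /h !permM; case: eqVneq => [->|pp'].
    by rewrite tpermL tpermR; ring.
  by rewrite !tpermD// blk_eq ?eqxx//= eq_sym.
apply: (le_trans (avg_expR_flips ht)).
have sz : (2 * #|{: 'I_(N %/ 4)}| <= N)%N by rewrite card_ord; lia.
have bound (k : 'I_4) : avg (fun s : 'S_N =>
    expR (\sum_p 8 * c ^+ 2 * b (r (al p)) (s (blk k p)) ^+ 2)) <=
    expR (800 * lam ^+ 2 * (N%:R^-1 * \sum_i \sum_k b i k ^+ 2)).
  pose z p k := 8 * c ^+ 2 * b (r (al p)) k ^+ 2.
  apply: (le_trans (@avg_expR_linear_pos _ (blk k) z (@blk_inj _ _) sz _)).
    move=> p l; rewrite /z cb andbT.
    by apply: mulr_ge0; [apply: mulr_ge0 => //|]; exact: sqr_ge0.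
  rewrite ler_expR /z.
  under eq_bigr do rewrite -mulr_sumr; rewrite -mulr_sumr.
  have raI : injective (r \o al) by apply: inj_comp; [exact: perm_inj | exact: blk_inj].
  have := @ler_sum_inj _ _ _ (r \o al) (fun i => \sum_k b i k ^+ 2) raI.
  move=> /(_ (fun i => sumr_ge0 _ (fun k _ => sqr_ge0 (b i k)))).
  set S := \sum_(q : 'I__) _; set S' := \sum_i _ => SS'.
  have S0 : 0 <= S by apply: sumr_ge0 => i _; apply: sumr_ge0 => l _; exact: sqr_ge0.
  have -> : 4 / N%:R * (8 * c ^+ 2 * S) = 32 * (N%:R^-1 * (c ^+ 2 * S)) by ring.
  have -> : 800 * lam ^+ 2 * (N%:R^-1 * S') =
    32 * (N%:R^-1 * (25 * lam ^+ 2 * S')) by ring.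
  rewrite ler_pM2l// ler_pM2l ?invr_gt0//.
  by apply: ler_pM => //; exact: sqr_ge0.
(* Here [2 h ^ 2 <= 4 c ^ 2 (u ^ 2 + v ^ 2)], and separating the two members of the pairs doubles
   the 4. *)
apply: (@le_trans _ _ (avg (fun s : 'S_N => 2^-1 *
   (expR (\sum_p 8 * c ^+ 2 * b (r (al p)) (s (al p)) ^+ 2) +
    expR (\sum_p 8 * c ^+ 2 * b (r (al p)) (s (al' p)) ^+ 2))))).
  apply: ler_avg => s.
  have half k : \sum_p 8 * c ^+ 2 * b (r (al p)) (s (blk k p)) ^+ 2 =
      2 * \sum_p 4 * c ^+ 2 * b (r (al p)) (s (blk k p)) ^+ 2.
    by rewrite mulr_sumr; apply: eq_bigr => p _; ring.
  rewrite !half; apply: (le_trans _ (expR_half _ _)); rewrite ler_expR.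
  rewrite -big_split mulr_sumr; apply: ler_sum => p _ /=.
  rewrite /h exprMn; have := sqr_ge0 c.
  set u := b _ _; set v := b _ _ => c0.
  have : (u - v) ^+ 2 <= 2 * u ^+ 2 + 2 * v ^+ 2.
    by have := sqr_ge0 (u + v); nra.
  by move=> /(ler_wpM2l c0); lra.
rewrite avgZ avgD; have := bound 0; have := bound 1; rewrite -/al -/al'; lra.
Qed.

End LinearStatistic.

(** * Degenerate quadratic statistics *)

Section QuadraticStatistic.
Variables (R : realType) (N : nat).
Hypothesis N20 : (20 <= N)%N.
Variable d : 'I_N -> 'I_N -> 'I_N -> 'I_N -> R.
Variable B : R.
Hypothesis B0 : 0 <= B.
Hypothesis dB : op_bounded d B.

Let n := (N %/ 4)%N.

Definition offdiag_sqsum : R :=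
  \sum_i \sum_(j | i != j) \sum_k \sum_(l | k != l) d i j k l ^+ 2.

(** The column bound is averaged over the permutations with [s y = l], an event of probability
    [1 / N]; this covers all [x] and [k] at once. *)
Lemma offdiag_sqsum_col (y l : 'I_N) :
  \sum_(x | x != y) \sum_(k | k != l) d x y k l ^+ 2 <= N%:R * B ^+ 2.
Proof.
have N1 : 0 <= N%:R - 1 :> R by rewrite subr_ge0 ler1n; lia.
have cE x : x != y -> \sum_(k | k != l) d x y k l ^+ 2 =
    N%:R * (N%:R - 1) * avg (fun s : 'S_N => (s y == l)%:R * d x y (s x) (s y) ^+ 2).
  move=> xy; rewrite (@avg_perm2 R N x y (fun k m => (m == l)%:R * d x y k m ^+ 2))//.
  rewrite [LHS]big_mkcond; apply: eq_bigr => k _; case: ifP => [kl|/eqP ->].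
    rewrite (bigD1 l) 1?eq_sym//= eqxx mul1r big1 ?addr0// => m /andP[_ /negbTE ->].
    by rewrite mul0r.
  by rewrite big1// => m /negbTE ->; rewrite mul0r.
rewrite (eq_bigr _ cE) -mulr_sumr -avg_sum.
apply: (@le_trans _ _ (N%:R * (N%:R - 1) * avg (fun s : 'S_N => (s y == l)%:R * B ^+ 2))).
  rewrite ler_wpM2l ?mulr_ge0//; apply: ler_avg => s.
  rewrite -mulr_sumr ler_wpM2l//; apply: le_trans (op_bounded_col dB s y).
  rewrite [leRHS](bigD1 y)//= lerDr; exact: sqr_ge0.
rewrite (@avg_perm1 R N y (fun m => (m == l)%:R * B ^+ 2)).
rewrite (bigD1 l)//= eqxx mul1r big1 ?addr0 => [|m /negbTE ->]; last by rewrite mul0r.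
have Npos : 0 < N%:R :> R by rewrite ltr0n; lia.
have -> : N%:R * (N%:R - 1) * (N%:R^-1 * B ^+ 2) = (N%:R - 1) * B ^+ 2.
  by field; rewrite gt_eqF.
by rewrite ler_wpM2r ?sqr_ge0// lerBlDr lerDl.
Qed.

(** The pairs [al true p], [al false p] serve the first argument and [be true q], [be false q] the
    second; as the blocks are disjoint, flips in one family do not affect the other. *)
Let al (b : bool) := @blk N (if b then 1 else 0).
Let be (b : bool) := @blk N (if b then 2%:R else 3%:R).

Let alI b : injective (al b). Proof. exact: blk_inj. Qed.
Let beI b : injective (be b). Proof. exact: blk_inj. Qed.
Let al_be b b' p q : al b p != be b' q.
Proof. by rewrite /al /be blk_eq; case: b b' => -[]. Qed.

Let be_al b b' p q : be b' q != al b p.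
Proof. by rewrite eq_sym al_be. Qed.

(** The arguments taken from [r] stay at the [true] positions; only those taken from [t] vary with
    [b] and [b']. *)
Let entry (r t : 'S_N) (b b' : bool) p q :=
  d (r (al true p)) (r (be true q)) (t (al b p)) (t (be b' q)).

Let entry_base (b b' : bool) : exists u : 'S_N, forall r t p q,
  entry r t b b' p q = entry r (u * t)%g true true p q.
Proof.
have [u [u1 u2]] := @swap_blk N 1 0 isT; have [v [v1 v2]] := @swap_blk N 2%:R 3%:R isT.
exists ((if b then 1 else u) * (if b' then 1 else v))%g => r t p q.
rewrite /entry !permM /al /be.
case: b b' => -[] /=; rewrite ?perm1 ?u1 ?u2 ?v1 ?v2 ?perm1 ?u1 ?u2 ?v1 ?v2 //.
Qed.

(** With [s = r^-1 * (u * t)] the entries form a submatrix of [d(i, j, s i, s j)]. *)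
Let entry_bnd r t b b' (x : 'I_n -> R) :
  \sum_q (\sum_p x p * entry r t b b' p q) ^+ 2 <= B ^+ 2 * \sum_p x p ^+ 2.
Proof.
have [u hu] := entry_base b b'.
have rI k : injective (fun p => r (@blk N k p)).
  by move=> p q /perm_inj /blk_inj.
have := @op_bounded_block _ _ _ _ dB (r^-1 * (u * t))%g _ _ _ x (rI 1) (rI 2%:R).
congr (_ <= _); apply: eq_bigr => q _; congr (_ ^+ 2); apply: eq_bigr => p _.
by rewrite hu /entry !permM !permK.
Qed.

Let entry_row r t b b' p : \sum_q entry r t b b' p q ^+ 2 <= B ^+ 2.
Proof.
have := entry_bnd r t b b' (fun p' => (p' == p)%:R).
rewrite [X in _ * X](bigD1 p)//= eqxx [X in _ * (_ + X)]big1 => [|k /negbTE ->];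
  last by rewrite expr0n.
rewrite expr1n addr0 mulr1; apply: le_trans; apply: ler_sum => q _.
rewrite (bigD1 p)//= eqxx big1 => [|k /negbTE ->]; last by rewrite mul0r.
by rewrite mul1r addr0.
Qed.

(** The values at the [al] positions are revealed first, given those at the [be] positions, then the
    latter: [1024 = 64 * 4 * 4]. The required smallness comes from the row bound and then from
    [offdiag_sqsum_col]. *)
Let avg_expR_sqentries (mu : R) r b b' : `|mu| * B <= 32^-1 ->
  avg (fun t => expR (\sum_p \sum_q 64 * mu ^+ 2 * entry r t b b' p q ^+ 2)) <=
  expR (1024 * mu ^+ 2 * (N%:R ^- 2 * offdiag_sqsum)).
Proof.
move=> muB; have Npos : 0 < N%:R :> R by rewrite ltr0n; lia.
have muB2 : mu ^+ 2 * B ^+ 2 <= 1024^-1.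
  rewrite -[mu ^+ 2]real_normK ?num_real// -exprMn.
  have : 0 <= `|mu| * B by rewrite mulr_ge0.
  by nra.
have m0 : 0 <= 64 * mu ^+ 2 by rewrite mulr_ge0// sqr_ge0.
pose x p := r (al true p); pose y q := r (be true q).
have xI : injective x by move=> p q /perm_inj /alI.
have yI : injective y by move=> p q /perm_inj /beI.
have xy p q : x p != y q by rewrite (inj_eq perm_inj) al_be.
pose g k p q l := 64 * mu ^+ 2 * d (x p) (y q) k l ^+ 2.
have g0 k p q l : 0 <= g k p q l by rewrite mulr_ge0// sqr_ge0.
pose C : {set 'I_N} := [set be b' q | q : 'I_n].
have cC : #|C| = n by rewrite card_imset ?card_ord.
pose z (t : 'S_N) p k := \sum_q g k p q (t (be b' q)).
have z0 t p k : 0 <= z t p k by apply: sumr_ge0.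
apply: (le_trans (@avg_expR_peel R N 'I_n (al b) C z (@alI b) _ _ z0 _ _)).
- by move=> p; apply/imsetP => -[q _ /eqP]; apply/negP; exact: al_be.
- by rewrite cC card_ord /n; lia.
- move=> t p; rewrite /z /g -mulr_sumr; apply: (@le_trans _ _ (64 * mu ^+ 2 * B ^+ 2)).
    by rewrite ler_wpM2l//; exact: entry_row.
  by lra.
- move=> a c s aC cC'; apply/funext => p; apply/funext => k; rewrite /z.
  apply: eq_bigr => q _; rewrite permM tpermD//.
    by apply: contraNneq aC => ->; exact: imset_f.
  by apply: contraNneq cC' => ->; exact: imset_f.
(* A position outside [C] carries a value other than [t (be b' q)], whence the restriction
   [k != l]. *)
pose z' q l := 4 / N%:R * \sum_p \sum_(k | k != l) g k p q l.
have z'E q l : z' q l = 256 * mu ^+ 2 / N%:R *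
    \sum_p \sum_(k | k != l) d (x p) (y q) k l ^+ 2.
  rewrite /z' /g; under eq_bigr do rewrite -mulr_sumr; rewrite -mulr_sumr.
  by ring.
have z'01 q l : 0 <= z' q l <= 2^-1.
  rewrite z'E; apply/andP; split.
    apply: mulr_ge0; first by rewrite divr_ge0// mulr_ge0// sqr_ge0.
    by apply: sumr_ge0 => p _; apply: sumr_ge0 => k _; exact: sqr_ge0.
  have h := offdiag_sqsum_col (y q) l.
  pose F i := if i != y q then \sum_(k | k != l) d i (y q) k l ^+ 2 else 0.
  have F0 i : 0 <= F i.
    by rewrite /F; case: ifP => // _; apply: sumr_ge0 => k _; exact: sqr_ge0.
  have hF : \sum_i F i <= N%:R * B ^+ 2 by rewrite /F -big_mkcond.
  have := le_trans (ler_sum_inj xI F0) hF.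
  rewrite (eq_bigr (fun p => \sum_(k | k != l) d (x p) (y q) k l ^+ 2)); last first.
    by move=> p _; rewrite /F xy.
  set S := \sum_p _ => SB.
  rewrite mulrAC ler_pdivrMr//.
  have := ler_wpM2l (sqr_ge0 mu) SB; nra.
apply: (@le_trans _ _ (avg (fun t : 'S_N => expR (\sum_q z' q (t (be b' q)))))).
  apply: ler_avg => t; rewrite ler_expR /z' -mulr_sumr ler_wpM2l ?divr_ge0//.
  rewrite [leRHS]exchange_big; apply: ler_sum => p _.
  rewrite /z exchange_big; apply: ler_sum => q _.
  rewrite [leRHS](reindex_inj (@perm_inj _ t)) /=.
  rewrite [leLHS]big_mkcond [leRHS]big_mkcond; apply: ler_sum => k _.
  case: ifP => [kC|_]; last by case: ifP.
  rewrite ifT// (inj_eq perm_inj); apply: contra kC => /eqP ->.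
  exact: imset_f.
apply: (le_trans (avg_expR_linear_pos (@beI b') _ z'01)).
  by rewrite card_ord /n; lia.
rewrite ler_expR.
under eq_bigr do under eq_bigr do rewrite z'E.
under eq_bigr do rewrite -mulr_sumr; rewrite -mulr_sumr.
have -> : 1024 * mu ^+ 2 * (N%:R ^- 2 * offdiag_sqsum) =
  4 / N%:R * (256 * mu ^+ 2 / N%:R * offdiag_sqsum).
  by rewrite -exprVn; ring.
apply: ler_wpM2l; first exact: divr_ge0.
apply: ler_wpM2l; first by rewrite divr_ge0// mulr_ge0// sqr_ge0.
pose H i j := \sum_l \sum_(k | k != l) d i j k l ^+ 2.
have H0 i j : 0 <= H i j.
  by apply: sumr_ge0 => k _; apply: sumr_ge0 => l _; exact: sqr_ge0.
have -> : offdiag_sqsum = \sum_i \sum_j if i != j then H i j else 0.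
  apply: eq_bigr => i _; rewrite big_mkcond; apply: eq_bigr => j _; case: ifP => // _.
  rewrite /H; under eq_bigr do rewrite big_mkcond.
  under [RHS]eq_bigr do rewrite big_mkcond.
  by rewrite exchange_big; apply: eq_bigr => l _; apply: eq_bigr => k _.
pose H' i j := if i != j then H i j else 0.
have H'0 i j : 0 <= H' i j by rewrite /H'; case: ifP.
apply: (@le_trans _ _ (\sum_p \sum_q H' (x p) (y q))).
  under eq_bigr do rewrite exchange_big /=.
  rewrite exchange_big /=; apply: ler_sum => p _.
  by apply: ler_sum => q _; rewrite /H' xy.
apply: (@le_trans _ _ (\sum_p \sum_j H' (x p) j)).
  by apply: ler_sum => p _; exact: ler_sum_inj.
by apply: (ler_sum_inj xI (F := fun i => \sum_j H' i j)) => i; exact: sumr_ge0.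
Qed.

(* Odd under exchanging the values of [t] at [al true p] and [al false p], or at
   [be true q] and [be false q]: this symmetry provides the random signs. *)
Definition mixed_diff (r t : 'S_N) (p q : 'I_n) : R :=
  entry r t true true p q - entry r t false true p q
  - entry r t true false p q + entry r t false false p q.

Lemma mixed_diff_mgf (mu : R) (r : 'S_N) : `|mu| * B <= 32^-1 ->
  avg (fun t => expR (\sum_p \sum_q mu * mixed_diff r t p q)) <=
  expR (1024 * mu ^+ 2 * (N%:R ^- 2 * offdiag_sqsum)).
Proof.
move=> muB.
have muB2 : mu ^+ 2 * B ^+ 2 <= 1024^-1.
  rewrite -[mu ^+ 2]real_normK ?num_real// -exprMn.
  have : 0 <= `|mu| * B by rewrite mulr_ge0.
  by nra.
pose t p := tperm (al true p) (al false p).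
pose v q := tperm (be true q) (be false q).
have four (a b c e : R) : (a - b - c + e) ^+ 2 <= 4 * (a ^+ 2 + b ^+ 2 + c ^+ 2 + e ^+ 2).
  have := sqr_ge0 (a + b); have := sqr_ge0 (a + c); have := sqr_ge0 (a - e).
  have := sqr_ge0 (b - c); have := sqr_ge0 (b + e); have := sqr_ge0 (c + e).
  by nra.
have flt s p p' q : mu * mixed_diff r (t p * s)%g p' q =
    if p' == p then - (mu * mixed_diff r s p' q) else mu * mixed_diff r s p' q.
  rewrite /mixed_diff /entry !permM !(@tpermD _ _ _ (be _ _)) ?al_be//.
  case: eqVneq => [->|pp']; first by rewrite tpermL tpermR; ring.
  by rewrite !tpermD// /al blk_eq ?[p == _]eq_sym ?(negbTE pp') ?andbF.
have flv s p q q' : mu * mixed_diff r (v q * s)%g p q' =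
    if q' == q then - (mu * mixed_diff r s p q') else mu * mixed_diff r s p q'.
  rewrite /mixed_diff /entry !permM !(@tpermD _ _ _ (al _ _)) ?be_al//.
  case: eqVneq => [->|pp']; first by rewrite tpermL tpermR; ring.
  by rewrite !tpermD// /be blk_eq ?[q == _]eq_sym ?(negbTE pp') ?andbF.
apply: (le_trans (avg_expR_flips2 flt flv _)).
  move=> s x.
  apply: (@le_trans _ _ (\sum_q 4 * mu ^+ 2 *
      ((\sum_p x p * entry r s true true p q) ^+ 2 +
       (\sum_p x p * entry r s false true p q) ^+ 2 +
       (\sum_p x p * entry r s true false p q) ^+ 2 +
       (\sum_p x p * entry r s false false p q) ^+ 2))).
    apply: ler_sum => q _.
    have -> : \sum_p x p * (mu * mixed_diff r s p q) = mu * (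
       \sum_p x p * entry r s true true p q - \sum_p x p * entry r s false true p q -
       \sum_p x p * entry r s true false p q + \sum_p x p * entry r s false false p q).
      rewrite -!sumrB -big_split mulr_sumr; apply: eq_bigr => p _ /=.
      by rewrite /mixed_diff; ring.
    by rewrite exprMn [4 * _]mulrC -[leRHS]mulrA; apply: ler_wpM2l => //; exact: sqr_ge0.
  rewrite -mulr_sumr !big_split /=.
  have e1 := entry_bnd r s true true x; have e2 := entry_bnd r s false true x.
  have e3 := entry_bnd r s true false x; have e4 := entry_bnd r s false false x.
  set X := \sum_p x p ^+ 2 in e1 e2 e3 e4 *.
  have X0 : 0 <= X by apply: sumr_ge0 => p _; exact: sqr_ge0.
  have e5 := lerD (lerD (lerD e1 e2) e3) e4.
  have := ler_wpM2l (sqr_ge0 mu) e5.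
  have := ler_wpM2r X0 muB2.
  lra.
(* The bound [16 mu ^ 2] times four sums of squares is a mean of four terms with coefficient
   [64 mu ^ 2], so that Jensen's inequality lets each kind of entry be treated alone. *)
pose S (t' : 'S_N) (b : bool * bool) :=
  \sum_p \sum_q 64 * mu ^+ 2 * entry r t' b.1 b.2 p q ^+ 2.
apply: (@le_trans _ _ (avg (fun t' => avg (fun b => expR (S t' b))))).
  apply: ler_avg => t'; apply: (le_trans _ (expR_avg (true, true) _)).
  rewrite ler_expR /avg card_prod card_bool.
  rewrite -(pair_bigA _ (fun b b' => \sum_p \sum_q
    64 * mu ^+ 2 * entry r t' b b' p q ^+ 2)) big_bool !big_bool /=.
  rewrite /S -!big_split !mulr_sumr; apply: ler_sum => p _ /=.
  rewrite -!big_split !mulr_sumr; apply: ler_sum => q _ /=.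
  rewrite exprMn; have := four (entry r t' true true p q) (entry r t' false true p q)
    (entry r t' true false p q) (entry r t' false false p q).
  by move=> /(ler_wpM2l (sqr_ge0 mu)); rewrite -/(mixed_diff _ _ _ _); lra.
rewrite exchange_avg; apply: (avg_le_cst (true, true)) => -[b b'].
exact: avg_expR_sqentries.
Qed.

End QuadraticStatistic.

(** * Conditional means of mixed differences *)

Section MoreMarginals.
Variables (R : realType) (N : nat).

(** Only the last value is integrated out, being uniform off the others, so that a vanishing
    marginal can be used at each stage. *)
Lemma avg_perm3 (a b c : 'I_N) (f : 'I_N -> 'I_N -> 'I_N -> R) :
  uniq [:: a; b; c] ->
  (N%:R - 2) * avg (fun r : 'S_N => f (r a) (r b) (r c)) =
  avg (fun r : 'S_N => \sum_(z | (z != r a) && (z != r b)) f (r a) (r b) z).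
Proof.
rewrite /= !inE !negb_or !andbT => /andP[/andP[ab ac] bc].
pose D := [set z | (z != a) && (z != b)].
have cD : (#|D| + 2 = N)%N.
  have -> : D = ~: [set a; b] by apply/setP => z; rewrite !inE negb_or.
  by have := cardsC [set a; b]; rewrite cards2 ab card_ord addnC.
have D0 : (0 < #|D|)%N by apply/card_gt0P; exists c; rewrite inE ![c == _]eq_sym ac bc.
have -> : N%:R - 2 = #|D|%:R :> R by rewrite -[in N%:R]cD natrD addrK.
rewrite (avg_tperm c _ D0) avgZ mulVKf ?pnatr_eq0 -?lt0n//; apply: eq_avg => s.
rewrite [RHS](reindex_inj (@perm_inj _ s)); apply: eq_big => z.
  by rewrite !inE !(inj_eq perm_inj).
by rewrite inE => /andP[za zb]; rewrite !permM tpermL !tpermD// eq_sym.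
Qed.

Lemma avg_perm4 (a b c e : 'I_N) (f : 'I_N -> 'I_N -> 'I_N -> 'I_N -> R) :
  uniq [:: a; b; c; e] ->
  (N%:R - 3) * avg (fun r : 'S_N => f (r a) (r b) (r c) (r e)) =
  avg (fun r : 'S_N => \sum_(z | [&& z != r a, z != r b & z != r c])
    f (r a) (r b) (r c) z).
Proof.
rewrite /= !inE !negb_or !andbT.
move=> /and3P[/and3P[ab ac ae] /andP[bc be] ce].
pose D := [set z | [&& z != a, z != b & z != c]].
have cD : (#|D| + 3 = N)%N.
  have -> : D = ~: (c |: [set a; b]).
    by apply/setP => z; rewrite !inE !negb_or; do 3! case: eqP.
  have := cardsC (c |: [set a; b]).
  by rewrite cardsU1 cards2 ab card_ord !inE negb_or ![c == _]eq_sym ac bc addnC.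
have D0 : (0 < #|D|)%N.
  by apply/card_gt0P; exists e; rewrite inE ![e == _]eq_sym ae be ce.
have -> : N%:R - 3 = #|D|%:R :> R by rewrite -[in N%:R]cD natrD addrK.
rewrite (avg_tperm e _ D0) avgZ mulVKf ?pnatr_eq0 -?lt0n//; apply: eq_avg => s.
rewrite [RHS](reindex_inj (@perm_inj _ s)); apply: eq_big => z.
  by rewrite !inE !(inj_eq perm_inj).
by rewrite inE => /and3P[za zb zc]; rewrite !permM tpermL !tpermD// eq_sym.
Qed.

Lemma sum_neq2 (x y : 'I_N) (f : 'I_N -> R) : x != y ->
  \sum_(z | (z != x) && (z != y)) f z = \sum_z f z - f x - f y.
Proof.
move=> xy; rewrite [in RHS](bigD1 x)//= [in RHS](bigD1 y) 1?eq_sym//=.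
by ring.
Qed.

Lemma sum_neq3 (x y u : 'I_N) (f : 'I_N -> R) : x != y -> x != u -> y != u ->
  \sum_(z | [&& z != x, z != y & z != u]) f z = \sum_z f z - f x - f y - f u.
Proof.
move=> xy xu yu; rewrite [in RHS](bigD1 x)//= [in RHS](bigD1 y) 1?eq_sym//=.
rewrite [in RHS](bigD1 u) /=; last by rewrite ![u == _]eq_sym xu yu.
under eq_bigl do rewrite andbA.
by ring.
Qed.

End MoreMarginals.

Section Degenerate.
Variables (R : realType) (N : nat).
Variable e : 'I_N -> 'I_N -> 'I_N -> 'I_N -> R.
Hypothesis e1 : forall j k l, \sum_i e i j k l = 0.
Hypothesis e2 : forall i k l, \sum_j e i j k l = 0.
Hypothesis e3 : forall i j l, \sum_k e i j k l = 0.
Hypothesis e4 : forall i j k, \sum_l e i j k l = 0.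

(** When a marginal vanishes, the sum over a value distinct from the earlier ones is minus the
    excluded terms. This reduces means in four and three values to means in two. *)
Lemma avg_mixed_diff (a b a' b' : 'I_N) : uniq [:: a; b; a'; b'] ->
  N%:R * (N%:R - 1) * (N%:R - 2) * (N%:R - 3) *
  avg (fun r : 'S_N => e (r a) (r b) (r a) (r b) - e (r a) (r b) (r a') (r b)
    - e (r a) (r b) (r a) (r b') + e (r a) (r b) (r a') (r b')) =
  (N%:R ^+ 2 - 3 * N%:R + 1) * (\sum_x \sum_(y | y != x) e x y x y)
  + \sum_x \sum_(y | y != x) e x y y x
  - 2 * (N%:R - 1) * (\sum_x e x x x x) + \sum_x \sum_k e x x k k.
Proof.
move=> un4; have := un4; rewrite /= !inE !negb_or !andbT.
move=> /and3P[/and3P[ab aa' ab'] /andP[ba' bb'] a'b'].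
have un3 : uniq [:: a; b; a'] by rewrite /= !inE !negb_or ab aa' ba'.
have un3' : uniq [:: a; b; b'] by rewrite /= !inE !negb_or ab ab' bb'.
have rab (r : 'S_N) : r a != r b by rewrite (inj_eq perm_inj).
pose E f := avg (fun r : 'S_N => f (r a) (r b)) : R.
have T2 : (N%:R - 2) * avg (fun r : 'S_N => e (r a) (r b) (r a') (r b)) =
    - E (fun x y => e x y x y) - E (fun x y => e x y y y).
  rewrite (avg_perm3 (fun x y z => e x y z y))// /E -avgN -avgB.
  by apply: eq_avg => r; rewrite sum_neq2// e3 sub0r.
have T3 : (N%:R - 2) * avg (fun r : 'S_N => e (r a) (r b) (r a) (r b')) =
    - E (fun x y => e x y x x) - E (fun x y => e x y x y).
  rewrite (avg_perm3 (fun x y z => e x y x z))// /E -avgN -avgB.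
  by apply: eq_avg => r; rewrite sum_neq2// e4 sub0r.
have T4 : (N%:R - 3) * avg (fun r : 'S_N => e (r a) (r b) (r a') (r b')) =
    - avg (fun r : 'S_N => e (r a) (r b) (r a') (r a))
    - avg (fun r : 'S_N => e (r a) (r b) (r a') (r b))
    - avg (fun r : 'S_N => e (r a) (r b) (r a') (r a')).
  rewrite (avg_perm4 e)// -avgN -!avgB.
  by apply: eq_avg => r; rewrite sum_neq3 ?(inj_eq perm_inj)// e4 sub0r.
have T5 : (N%:R - 2) * avg (fun r : 'S_N => e (r a) (r b) (r a') (r a)) =
    - E (fun x y => e x y x x) - E (fun x y => e x y y x).
  rewrite (avg_perm3 (fun x y z => e x y z x))// /E -avgN -avgB.
  by apply: eq_avg => r; rewrite sum_neq2// e3 sub0r.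
(* Two arguments vary together here, so that no marginal applies and the sum over [k] survives. *)
have T6 : (N%:R - 2) * avg (fun r : 'S_N => e (r a) (r b) (r a') (r a')) =
    E (fun x y => \sum_k e x y k k) - E (fun x y => e x y x x)
    - E (fun x y => e x y y y).
  rewrite (avg_perm3 (fun x y z => e x y z z))// /E -!avgB.
  by apply: eq_avg => r; rewrite sum_neq2.
pose L := \sum_x e x x x x.
have ML : N%:R * (N%:R - 1) * E (fun x y => e x y x x) = - L.
  rewrite /E (avg_perm2 (fun x y => e x y x x))// /L -sumrN; apply: eq_bigr => x _.
  by have := e2 x x x; rewrite (bigD1 x)//= => /eqP; rewrite addrC addr_eq0 => /eqP.
have ML' : N%:R * (N%:R - 1) * E (fun x y => e x y y y) = - L.
  rewrite /E (avg_perm2 (fun x y => e x y y y))// /L -sumrN.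
  rewrite (exchange_big_dep xpredT)//=; apply: eq_bigr => y _.
  have := e1 y y y; rewrite (bigD1 y)//= => /eqP; rewrite addrC addr_eq0 => /eqP <-.
  by apply: eq_bigl => x; rewrite eq_sym.
have MG : N%:R * (N%:R - 1) * E (fun x y => \sum_k e x y k k) =
    - \sum_x \sum_k e x x k k.
  rewrite /E (avg_perm2 (fun x y => \sum_k e x y k k))// -sumrN.
  apply: eq_bigr => x _; rewrite exchange_big -sumrN; apply: eq_bigr => k _.
  by have := e2 x k k; rewrite (bigD1 x)//= => /eqP; rewrite addrC addr_eq0 => /eqP.
have MU := avg_perm2 (fun x y => e x y x y) ab.
have MT := avg_perm2 (fun x y => e x y y x) ab.
rewrite -/(E _) in MU; rewrite -/(E _) in MT.
rewrite -/L; move: ML ML' MG MU MT T2 T3 T4 T5 T6.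
rewrite avgD !avgB -/(E (fun x y => e x y x y)).
set n := N%:R; set u := E (fun x y => e x y x y); set ut := E (fun x y => e x y y x).
set lx := E (fun x y => e x y x x); set ly := E (fun x y => e x y y y).
set g := E _; set t2 := avg (fun r : 'S_N => e (r a) (r b) (r a') (r b)).
set t3 := avg (fun r : 'S_N => e (r a) (r b) (r a) (r b')).
set t4 := avg (fun r : 'S_N => e (r a) (r b) (r a') (r b')).
set t5 := avg (fun r : 'S_N => e (r a) (r b) (r a') (r a)).
set t6 := avg (fun r : 'S_N => e (r a) (r b) (r a') (r a')).
set U := \sum_x _; set T := \sum_x _; set G := \sum_x _.
move=> ML ML' MG MU MT T2 T3 T4 T5 T6.
(* The factors are distributed so that every reduction applies without division. *)
have -> : n * (n - 1) * (n - 2) * (n - 3) * (u - t2 - t3 + t4) =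
  n * (n - 1) * ((n - 2) * (n - 3) * u - (n - 3) * ((n - 2) * t2)
    - (n - 3) * ((n - 2) * t3) + (n - 2) * ((n - 3) * t4)) by ring.
rewrite T4.
have -> : (n - 2) * (- t5 - t2 - t6) = - ((n - 2) * t5) - (n - 2) * t2 - (n - 2) * t6.
  by ring.
rewrite T2 T3 T5 T6.
have -> : n * (n - 1) * ((n - 2) * (n - 3) * u - (n - 3) * (- u - ly)
  - (n - 3) * (- lx - u) + (- (- lx - ut) - (- u - ly) - (g - lx - ly))) =
  (n ^+ 2 - 3 * n + 1) * (n * (n - 1) * u) + n * (n - 1) * ut
  + (n - 1) * (n * (n - 1) * lx + n * (n - 1) * ly) - n * (n - 1) * g by ring.
by rewrite ML ML' MG MU MT; ring.
Qed.

End Degenerate.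

Lemma sumr_ord_const (R : pzSemiRingType) n (c : R) : \sum_(i < n) c = n%:R * c.
Proof. by rewrite sumr_const card_ord mulr_natl. Qed.

(** Cauchy-Schwarz, as nonnegativity of the variance. *)
Lemma sqr_sum_le (R : realType) (T : finType) (f : T -> R) :
  (\sum_x f x) ^+ 2 <= #|T|%:R * \sum_x f x ^+ 2.
Proof.
have [T0|Tn0] := eqVneq #|T| 0%N.
  have none (x : T) : false by have := max_card (pred1 x); rewrite T0 card1.
  by rewrite T0 mul0r big1 ?expr0n// => x; have := none x.
have Tp : 0 < #|T|%:R :> R by rewrite ltr0n lt0n.
set S := \sum_x f x; pose m := S / #|T|%:R.
have : 0 <= \sum_x (f x - m) ^+ 2 by apply: sumr_ge0 => x _; exact: sqr_ge0.
have -> : \sum_x (f x - m) ^+ 2 = \sum_x f x ^+ 2 - 2 * m * S + #|T|%:R * m ^+ 2.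
  have <- : \sum_(x : T) m ^+ 2 = #|T|%:R * m ^+ 2.
    by rewrite sumr_const mulr_natl.
  rewrite /S mulr_sumr -sumrB -big_split.
  by apply: eq_bigr => x _ /=; ring.
have -> : S = #|T|%:R * m by rewrite /m mulrC divfK ?gt_eqF.
move=> h; have := ler_wpM2l (ltW Tp) h; rewrite mulr0; lra.
Qed.

(** In the quadratic bound of the exponential the linear term averages to 0, and the variance is at
    most the second moment. *)
Lemma avg_expR_small (R : realType) (T : finType) (x0 : T) (Y : T -> R) (c : R) :
  (forall x, c * (Y x - avg Y) <= 2^-1) ->
  avg (fun x => expR (c * (Y x - avg Y))) <=
  expR (2 * c ^+ 2 * avg (fun x => Y x ^+ 2)).
Proof.
move=> small; set m := avg Y.
apply: (@le_trans _ _ (avg (fun x => 1 + c * (Y x - m) + 2 * (c * (Y x - m)) ^+ 2))).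
  by apply: ler_avg => x; exact: expR_le_quad.
apply: (le_trans _ (expR_ge1Dx _)).
rewrite !avgD (avg_cst x0) -addrA lerD2l avgZ avgB (avg_cst x0) subrr mulr0 add0r.
rewrite avgZ -mulrA ler_pM2l//.
under eq_avg do rewrite exprMn; rewrite avgZ ler_wpM2l ?sqr_ge0//.
have -> : avg (fun x => (Y x - m) ^+ 2) =
    avg (fun x => Y x ^+ 2) - m ^+ 2.
  rewrite (eq_avg (g := fun x => Y x ^+ 2 - (2 * m * Y x - m ^+ 2))); last first.
    by move=> x; ring.
  by rewrite avgB avgB avgZ (avg_cst x0) -/m; ring.
by rewrite gerBl sqr_ge0.
Qed.

(** * Exponential moments of degenerate quadratic statistics *)

Section DegenerateMgf.
Variables (R : realType) (N : nat).
Hypothesis N20 : (20 <= N)%N.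
Variable d : 'I_N -> 'I_N -> 'I_N -> 'I_N -> R.
Variable B : R.
Hypothesis B0 : 0 <= B.
Hypothesis dB : op_bounded d B.
Hypothesis d1 : forall j k l, \sum_i d i j k l = 0.
Hypothesis d2 : forall i k l, \sum_j d i j k l = 0.
Hypothesis d3 : forall i j l, \sum_k d i j k l = 0.
Hypothesis d4 : forall i j k, \sum_l d i j k l = 0.

(** The double centring of the matrix [d(i, i, k, k)]; for [d_of w] it is [xi_of w]. *)
Definition diag_centered (i k : 'I_N) : R :=
  d i i k k - N%:R^-1 * (\sum_k' d i i k' k') - N%:R^-1 * (\sum_i' d i' i' k k)
  + (N%:R ^+ 2)^-1 * (\sum_i' \sum_k' d i' i' k' k').

Let Npos : 0 < N%:R :> R. Proof. by rewrite ltr0n; lia. Qed.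
Let Nge : 20 <= N%:R :> R. Proof. by rewrite ler_nat. Qed.
Let npos : 0 < (N %/ 4)%:R :> R. Proof. by rewrite ltr0n; lia. Qed.

Lemma diag_centered_row i : \sum_k diag_centered i k = 0.
Proof.
rewrite /diag_centered big_split !sumrB /= -!mulr_sumr !sumr_ord_const.
have -> : \sum_k \sum_i' d i' i' k k = \sum_i' \sum_k d i' i' k k.
  exact: exchange_big.
by field; rewrite gt_eqF.
Qed.

Lemma diag_centered_le i k : `|diag_centered i k| <= 4 * B.
Proof.
have dle j l : `|d j j l l| <= B.
  have := @op_bounded_entry _ _ _ _ dB (tperm j l) j j B0; by rewrite tpermL.
have avgle (f : 'I_N -> R) c : (forall i, `|f i| <= c) -> `|N%:R^-1 * \sum_i f i| <= c.
  move=> fc; rewrite normrM gtr0_norm ?invr_gt0// mulrC ler_pdivrMr//.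
  apply: (le_trans (ler_norm_sum _ _ _)); apply: (le_trans (ler_sum _ (fun i _ => fc i))).
  by rewrite sumr_ord_const mulrC.
rewrite /diag_centered.
have h1 := avgle _ _ (fun k' => dle i k'); have h2 := avgle _ _ (fun i' => dle i' k).
have h3 := avgle _ _ (fun i' => avgle _ _ (fun k' => dle i' k')).
have E : (N%:R ^+ 2)^-1 * \sum_i' \sum_k' d i' i' k' k' =
    N%:R^-1 * \sum_i' (N%:R^-1 * \sum_k' d i' i' k' k').
  by rewrite -mulr_sumr mulrA -exprVn expr2.
rewrite E; have := dle i k.
move: (N%:R^-1 * _) h1 => x1 h1; move: (N%:R^-1 * _) h2 => x2 h2.
move: (N%:R^-1 * _) h3 => x3 h3 h0.
apply: (le_trans (ler_normD _ _)); rewrite -normrN in h1; rewrite -normrN in h2.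
have := ler_normD (d i i k k - x1) (- x2); have := ler_normD (d i i k k) (- x1).
by lra.
Qed.

(** [U] and [L] are the off-diagonal and diagonal parts of [Q d]; [Ut], with values exchanged,
    appears in the conditional mean of the mixed differences. *)
Let U (s : 'S_N) : R := \sum_x \sum_(y | y != x) d x y (s x) (s y).
Let Ut (s : 'S_N) : R := \sum_x \sum_(y | y != x) d x y (s y) (s x).
Let L (s : 'S_N) : R := \sum_x d x x (s x) (s x).

Let Q_split s : Q d s = L s + U s.
Proof.
rewrite /Q /L /U -big_split; apply: eq_bigr => x _.
by rewrite (bigD1 x).
Qed.

Let L_centered s : L s - avg L = linear_stat diag_centered s.
Proof.
have -> : avg L = N%:R^-1 * \sum_i \sum_k d i i k k.
  rewrite /L avg_sum mulr_sumr; apply: eq_bigr => i _.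
  exact: (avg_perm1 i (fun k => d i i k k)).
rewrite /linear_stat /diag_centered big_split !sumrB /= -!mulr_sumr sumr_ord_const.
have -> : \sum_i \sum_i' d i' i' (s i) (s i) = \sum_i \sum_k d i i k k.
  rewrite exchange_big; apply: eq_bigr => i _.
  by rewrite [RHS](reindex_inj (@perm_inj _ s)).
by rewrite -/(L s); field; rewrite gt_eqF.
Qed.

Let Ut_bounded s : `|Ut s| <= N%:R ^+ 2 * B.
Proof.
have dle x y : `|d x y (s y) (s x)| <= B.
  by have := @op_bounded_entry _ _ _ _ dB (tperm x y * s)%g x y B0; rewrite !permM tpermL tpermR.
rewrite (le_trans (ler_norm_sum _ _ _))// expr2 -mulrA.
apply: (@le_trans _ _ (\sum_(x < N) N%:R * B)); last first.
  by rewrite sumr_ord_const.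
apply: ler_sum => x _; rewrite (le_trans (ler_norm_sum _ _ _))//.
apply: (@le_trans _ _ (\sum_(y < N) B)); last first.
  by rewrite sumr_ord_const.
by rewrite big_mkcond; apply: ler_sum => y _; case: ifP.
Qed.

(** Cauchy-Schwarz over the pairs, the two-point marginals, and [N ^ 2 <= 2 N (N - 1)]. *)
Let Ut_sqr : avg (fun s => Ut s ^+ 2) <= 2 * offdiag_sqsum d.
Proof.
pose F x y (k l : 'I_N) := if y != x then d x y k l ^+ 2 else 0.
apply: (@le_trans _ _ (N%:R ^+ 2 * \sum_x \sum_(y | y != x)
    avg (fun s : 'S_N => d x y (s y) (s x) ^+ 2))).
  have -> : \sum_x \sum_(y | y != x) avg (fun s : 'S_N => d x y (s y) (s x) ^+ 2) =
      avg (fun s : 'S_N => \sum_x \sum_(y | y != x) d x y (s y) (s x) ^+ 2).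
    by rewrite avg_sum; apply: eq_bigr => x _; rewrite avg_sum.
  rewrite -avgZ.
  apply: ler_avg => s; rewrite /Ut expr2 -mulrA.
  apply: (le_trans (sqr_sum_le _)); rewrite card_ord ler_wpM2l// mulr_sumr.
  apply: ler_sum => x _; rewrite big_mkcond [X in _ * X]big_mkcond.
  apply: (le_trans (sqr_sum_le _)); rewrite card_ord ler_wpM2l//.
  by apply: ler_sum => y _; case: ifP => // _; rewrite expr0n.
have -> : \sum_x \sum_(y | y != x) avg (fun s : 'S_N => d x y (s y) (s x) ^+ 2) =
    (N%:R * (N%:R - 1))^-1 * offdiag_sqsum d.
  rewrite /offdiag_sqsum mulr_sumr; apply: eq_bigr => x _.
  under [in RHS]eq_bigl do rewrite eq_sym.
  rewrite mulr_sumr; apply: eq_bigr => y yx.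
  have := @avg_perm2 R N y x (fun k l => d x y k l ^+ 2) yx.
  move=> /(canRL (mulKf _)) ->; last by rewrite mulf_neq0 ?gt_eqF// subr_gt0; have := Nge; lra.
  by congr (_ * _); apply: eq_bigr => k _; apply: eq_bigl => l; rewrite eq_sym.
have O0 : 0 <= offdiag_sqsum d.
  by do 4! [apply: sumr_ge0 => ? _]; exact: sqr_ge0.
have Ng := Nge; rewrite mulrA ler_wpM2r// ler_pdivrMr ?mulr_gt0 ?subr_gt0//; last by lra.
by nra.
Qed.

(** The coefficient of the main term in [avg_mixed_diff]; [theta] then normalizes the sum of
    [(N %/ 4) ^ 2] mixed differences so as to recover [U]. *)
Let kappa : R := N%:R ^+ 2 - 3 * N%:R + 1.
Let kappa_gt0 : 0 < kappa. Proof. by rewrite /kappa; have := Nge; nra. Qed.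
Let theta : R := N%:R * (N%:R - 1) * (N%:R - 2) * (N%:R - 3) /
  (kappa * (N %/ 4)%:R ^+ 2).

Let theta_bnd : 0 <= theta <= 25.
Proof.
have n5 := natr_le5 R N20; have Ng := Nge; have k0 := kappa_gt0.
have n0 := npos.
rewrite /theta; apply/andP; split.
  apply: divr_ge0; last by rewrite mulr_ge0 ?sqr_ge0// ltW.
  by do 3! [apply: mulr_ge0; last by lra].
rewrite ler_pdivrMr ?mulr_gt0 ?exprn_gt0//.
apply: (@le_trans _ _ (kappa * N%:R ^+ 2)).
  by rewrite /kappa; nra.
have -> : 25 * (kappa * (N %/ 4)%:R ^+ 2) = kappa * (25 * (N %/ 4)%:R ^+ 2) by ring.
by rewrite ler_pM2l//; nra.
Qed.

Let A (s : 'S_N) : R :=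
  avg (fun r => \sum_p \sum_q mixed_diff d r (r * s)%g p q).

Let A_E s : theta * A s = U s + kappa^-1 *
  (Ut s - 2 * (N%:R - 1) * L s + \sum_x \sum_k d x x k k).
Proof.
(* Relabelling the values by [s] turns [r * s] into [r] and preserves the vanishing marginals. *)
pose e x y k l := d x y (s k) (s l).
have margin (f : 'I_N -> R) : \sum_k f (s k) = \sum_k f k.
  by rewrite [RHS](reindex_inj (@perm_inj _ s)).
have AE : A s = (N %/ 4)%:R ^+ 2 *
   ((N%:R * (N%:R - 1) * (N%:R - 2) * (N%:R - 3))^-1 *
    (kappa * U s + Ut s - 2 * (N%:R - 1) * L s + \sum_x \sum_k d x x k k)).
  have NN0 : N%:R * (N%:R - 1) * (N%:R - 2) * (N%:R - 3) != 0 :> R.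
    by rewrite !mulf_neq0// gt_eqF// subr_gt0; have := Nge; lra.
  have term p q : avg (fun r => mixed_diff d r (r * s)%g p q) =
     (N%:R * (N%:R - 1) * (N%:R - 2) * (N%:R - 3))^-1 *
    (kappa * U s + Ut s - 2 * (N%:R - 1) * L s + \sum_x \sum_k d x x k k).
    rewrite -[LHS](mulKf NN0); congr (_ * _).
    have e1 j k l : \sum_i e i j k l = 0 by exact: d1.
    have e2 i k l : \sum_j e i j k l = 0 by exact: d2.
    have e3 i j l : \sum_k e i j k l = 0.
      by rewrite /e (margin (fun k => d i j k (s l))).
    have e4 i j k : \sum_l e i j k l = 0 by rewrite /e (margin (d i j (s k))).
    have un : uniq [:: blk 1 p; blk 2%:R q; blk 0 p; blk 3%:R q].
      by rewrite /= !inE !blk_eq.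
    have := avg_mixed_diff e1 e2 e3 e4 un.
    have -> : \sum_x \sum_k e x x k k = \sum_x \sum_k d x x k k.
      by apply: eq_bigr => x _; rewrite (margin (fun k => d x x k k)).
    by move=> <-; congr (_ * _); apply: eq_avg => r; rewrite /mixed_diff !permM.
  rewrite /A avg_sum; under eq_bigr do rewrite avg_sum.
  under eq_bigr do under eq_bigr do rewrite term.
  by rewrite !sumr_ord_const mulrA -expr2.
rewrite AE /theta; move: (N %/ 4)%:R npos => m m0; have k0 := kappa_gt0.
have Ng := Nge; field.
by rewrite !subr_eq0 !gt_eqF //=; lra.
Qed.

(** Exchanging the values at one [al] pair changes the sign of the mixed difference. *)
Let A_mean : avg A = 0.
Proof.
rewrite /A exchange_avg -[RHS](avg_cst (1%g : 'S_N)); apply: eq_avg => r.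
rewrite (avg_mull r (fun t => \sum_p \sum_q mixed_diff d r t p q)).
rewrite avg_sum big1// => p _; rewrite avg_sum big1// => q _.
set F := fun t => _; have : avg F = - avg F; last by lra.
rewrite -[LHS](avg_mull (tperm (blk 1 p) (blk 0 p))) -avgN; apply: eq_avg => t.
by rewrite /F /mixed_diff !permM tpermL tpermR !tpermD ?blk_eq//; ring.
Qed.

(** The double sum of [d x x k k] is deterministic and disappears on centring; the diagonal parts of
    [Q d] and of [theta * A] merge into one linear statistic. *)
Let Q_centered s : Q d s - avg (Q d) =
  theta * A s - kappa^-1 * (Ut s - avg Ut)
  + (1 + 2 * (N%:R - 1) / kappa) * linear_stat diag_centered s.
Proof.
have QE u : Q d u = theta * A u - kappa^-1 * Ut u +
    (1 + 2 * (N%:R - 1) / kappa) * L u - kappa^-1 * \sum_x \sum_k d x x k k.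
  by rewrite Q_split A_E; ring.
rewrite -L_centered (eq_avg QE) avgB avgD avgB (avgZ theta A) (avgZ _ Ut) (avgZ _ L).
rewrite A_mean QE.
by rewrite (avg_cst (1%g : 'S_N)); ring.
Qed.

(** The three parts are separated with factors 2, 4 and 4. As [theta <= 25], the main part meets its
    smallness condition by [50 / 1600 = 1 / 32], and [1024 * 50 ^ 2 = 1600 ^ 2]. *)
Lemma degenerate_mgf (lam : R) : `|lam| * B <= 1600^-1 ->
  avg (fun s => expR (lam * (Q d s - avg (Q d)))) <=
  expR (1600 ^+ 2 * lam ^+ 2 *
    (N%:R^-1 * (\sum_i \sum_k diag_centered i k ^+ 2) + N%:R ^- 2 * offdiag_sqsum d)).
Proof.
move=> lamB; set V1 := N%:R^-1 * _; set V2 := N%:R ^- 2 * _.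
have V10 : 0 <= V1.
  apply: mulr_ge0; first by rewrite invr_ge0.
  by do 2! [apply: sumr_ge0 => ? _]; exact: sqr_ge0.
have V20 : 0 <= V2.
  apply: mulr_ge0; first by rewrite invr_ge0 sqr_ge0.
  by do 4! [apply: sumr_ge0 => ? _]; exact: sqr_ge0.
have l0 := sqr_ge0 lam.
have Ng := Nge; have k0 := kappa_gt0; have /andP[th0 th25] := theta_bnd.
set bound := expR _.
have HA : avg (fun s => expR (2 * (lam * (theta * A s)))) <= bound.
  apply: (@le_trans _ _ (expR (1024 * (2 * lam * theta) ^+ 2 * V2))); last first.
    rewrite ler_expR.
    have h : (2 * lam * theta) ^+ 2 <= 2500 * lam ^+ 2.
      have : theta ^+ 2 <= 625 by nra.
      by move=> /(ler_wpM2l l0); nra.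
    have := ler_wpM2r V20 h; have := mulr_ge0 l0 V10.
    by nra.
  rewrite (eq_avg (g := fun s => expR (avg (fun r =>
     \sum_p \sum_q (2 * lam * theta) * mixed_diff d r (r * s)%g p q)))); last first.
    move=> s; congr expR; have -> : 2 * (lam * (theta * A s)) = 2 * lam * theta * A s.
      by ring.
    rewrite /A -(avgZ (2 * lam * theta)).
    apply: eq_avg => r; rewrite mulr_sumr; apply: eq_bigr => p _.
    by rewrite mulr_sumr.
  apply: (avg_expR_decouple (X := fun r t =>
    \sum_p \sum_q (2 * lam * theta) * mixed_diff d r t p q)) => r.
  apply: (mixed_diff_mgf N20 B0 dB).
  rewrite (normrM (2 * lam)) (normrM 2) (ger0_norm th0) (ger0_norm (ler0n R 2)).
  have := mulr_ge0 (normr_ge0 lam) B0; nra.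
have HU : avg (fun s => expR (4 * (- (lam / kappa) * (Ut s - avg Ut)))) <= bound.
  rewrite (eq_avg (g := fun s => expR (- (4 * lam / kappa) * (Ut s - avg Ut)))); last first.
    by move=> s; congr expR; ring.
  apply: (le_trans (@avg_expR_small _ _ (1%g : 'S_N) Ut _ _)).
    move=> s; apply: (le_trans (ler_norm _)); rewrite normrM normrN !normrM.
    rewrite [`|4|]ger0_norm// [`|kappa^-1|]gtr0_norm ?invr_gt0//.
    have mB : `|avg Ut| <= N%:R ^+ 2 * B.
      have nz : - (N%:R ^+ 2 * B) <= avg Ut.
        rewrite -[leLHS](avg_cst (1%g : 'S_N)); apply: ler_avg => u.
        by have := Ut_bounded u; rewrite ler_norml => /andP[].
      rewrite ler_norml nz; apply: (avg_le_cst (1%g : 'S_N)) => u.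
      by have := Ut_bounded u; rewrite ler_norml => /andP[].
    have h : `|Ut s - avg Ut| <= 2 * (N%:R ^+ 2 * B).
      apply: (le_trans (ler_normB _ _)); have := Ut_bounded s; lra.
    have h2 : kappa^-1 * N%:R ^+ 2 <= 2.
      by rewrite mulrC ler_pdivrMr// /kappa; nra.
    have lk0 : 0 <= 4 * `|lam| / kappa by rewrite divr_ge0 ?mulr_ge0// ltW.
    apply: (le_trans (ler_wpM2l lk0 h)).
    have -> : 4 * `|lam| / kappa * (2 * (N%:R ^+ 2 * B)) =
      8 * (`|lam| * B) * (kappa^-1 * N%:R ^+ 2) by ring.
    have lB0 := mulr_ge0 (normr_ge0 lam) B0.
    have := ler_wpM2l lB0 h2; lra.
  rewrite ler_expR sqrrN.
  apply: (@le_trans _ _ (64 * lam ^+ 2 * V2)); last first.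
    have := mulr_ge0 l0 V10; have := mulr_ge0 l0 V20; lra.
  apply: (@le_trans _ _ (2 * (4 * lam / kappa) ^+ 2 * (2 * offdiag_sqsum d))).
    by rewrite ler_wpM2l// mulr_ge0// sqr_ge0.
  have -> : 2 * (4 * lam / kappa) ^+ 2 * (2 * offdiag_sqsum d) =
    64 * lam ^+ 2 * (kappa ^- 2 * offdiag_sqsum d) by rewrite -exprVn; ring.
  apply: ler_wpM2l; first by rewrite mulr_ge0.
  apply: ler_wpM2r; first by do 4! [apply: sumr_ge0 => ? _]; exact: sqr_ge0.
  rewrite lef_pV2 ?posrE ?exprn_gt0// lerXn2r ?nnegrE ?ltW//.
  by rewrite /kappa; nra.
have HL : avg (fun s => expR (4 * (lam * (1 + 2 * (N%:R - 1) / kappa) *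
    linear_stat diag_centered s))) <= bound.
  set c := 1 + _; have c02 : 0 <= c <= 2.
    apply/andP; split.
      apply: addr_ge0 => //; apply: divr_ge0; last exact: ltW.
      by lra.
    have : 2 * (N%:R - 1) / kappa <= 1 by rewrite ler_pdivrMr// /kappa; nra.
    by rewrite /c; lra.
  have /andP[c0 c2] := c02.
  rewrite (eq_avg (g := fun s => expR (4 * lam * c * linear_stat diag_centered s))); last first.
    by move=> s; rewrite !mulrA.
  apply: (le_trans (linear_mgf N20 diag_centered_row diag_centered_le _)).
    rewrite !normrM [`|c|]ger0_norm// [`|4|]ger0_norm//.
    have := mulr_ge0 (normr_ge0 lam) B0; nra.
  rewrite ler_expR -/V1.
  have h : (4 * lam * c) ^+ 2 <= 64 * lam ^+ 2.
    have : c ^+ 2 <= 4 by nra.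
    by move=> /(ler_wpM2l l0); nra.
  have := ler_wpM2r V10 h; have := mulr_ge0 l0 V20; have := mulr_ge0 l0 V10.
  by lra.
apply: (@le_trans _ _ (avg (fun s => 2^-1 * (expR (2 * (lam * (theta * A s))) +
    2^-1 * (expR (4 * (- (lam / kappa) * (Ut s - avg Ut))) +
      expR (4 * (lam * (1 + 2 * (N%:R - 1) / kappa) * linear_stat diag_centered s))))))).
  apply: ler_avg => s; rewrite Q_centered.
  set x := lam * (theta * A s); set y := - (lam / kappa) * (Ut s - avg Ut).
  set z := lam * (1 + _) * _.
  have -> : lam * (theta * A s - kappa^-1 * (Ut s - avg Ut) +
      (1 + 2 * (N%:R - 1) / kappa) * linear_stat diag_centered s) = x + (y + z).
    by rewrite /x /y /z; ring.
  apply: (le_trans (expR_half _ _)); rewrite ler_pM2l// lerD2l.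
  rewrite mulrDr; apply: (le_trans (expR_half _ _)).
  by rewrite !mulrA -natrM.
by rewrite avgZ avgD avgZ avgD; lra.
Qed.

End DegenerateMgf.

(** * Hoeffding decomposition and conclusion *)

Local Arguments dotted : simpl never.

Section HoeffdingDecomposition.
Variables (R : realType) (N : nat).
Hypothesis N0 : (0 < N)%N.
Variable w : 'I_N -> 'I_N -> 'I_N -> 'I_N -> R.

Let Nn0 : N%:R != 0 :> R. Proof. by rewrite pnatr_eq0 -lt0n. Qed.

Lemma at_or_mean_sum (o : option 'I_N) (F : 'I_N -> 'I_N -> R) :
  \sum_y at_or_mean o (F^~ y) = at_or_mean o (fun x => \sum_y F x y).
Proof. by case: o => //=; rewrite -mulr_sumr exchange_big. Qed.

Lemma at_or_meanZ (o : option 'I_N) (F : 'I_N -> R) c :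
  at_or_mean o (fun x => c * F x) = c * at_or_mean o F.
Proof. by case: o => //=; rewrite -mulr_sumr mulrCA. Qed.

Let sum_at_or_mean (f : 'I_N -> R) :
  \sum_i at_or_mean (Some i) f = N%:R * at_or_mean None f.
Proof. by rewrite /= mulVKf. Qed.

Lemma sum_dotted1 j k l :
  \sum_i dotted w (Some i) j k l = N%:R * dotted w None j k l.
Proof. exact: sum_at_or_mean. Qed.

Lemma sum_dotted2 i k l :
  \sum_j dotted w i (Some j) k l = N%:R * dotted w i None k l.
Proof.
rewrite /dotted at_or_mean_sum -at_or_meanZ; congr at_or_mean; apply/funext => i'.
exact: sum_at_or_mean.
Qed.

Lemma sum_dotted3 i j l :
  \sum_k dotted w i j (Some k) l = N%:R * dotted w i j None l.
Proof.
rewrite /dotted at_or_mean_sum -at_or_meanZ; congr at_or_mean; apply/funext => i'.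
rewrite at_or_mean_sum -at_or_meanZ; congr at_or_mean; apply/funext => j'.
exact: sum_at_or_mean.
Qed.

Lemma sum_dotted4 i j k :
  \sum_l dotted w i j k (Some l) = N%:R * dotted w i j k None.
Proof.
rewrite /dotted at_or_mean_sum -at_or_meanZ; congr at_or_mean; apply/funext => i'.
rewrite at_or_mean_sum -at_or_meanZ; congr at_or_mean; apply/funext => j'.
rewrite at_or_mean_sum -at_or_meanZ; congr at_or_mean; apply/funext => k'.
exact: sum_at_or_mean.
Qed.

Let wE i j k l : w i j k l = dotted w (Some i) (Some j) (Some k) (Some l).
Proof. by []. Qed.

(** After summation, each term cancels the one in which the summed argument is a dot. *)
Lemma d_of_sum1 j k l : \sum_i d_of w i j k l = 0.
Proof.
rewrite /d_of; under eq_bigr do rewrite wE.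
by rewrite !(big_split, sumrN) /= !sum_dotted1 !sumr_ord_const; ring.
Qed.

Lemma d_of_sum2 i k l : \sum_j d_of w i j k l = 0.
Proof.
rewrite /d_of; under eq_bigr do rewrite wE.
by rewrite !(big_split, sumrN) /= !sum_dotted2 !sumr_ord_const; ring.
Qed.

Lemma d_of_sum3 i j l : \sum_k d_of w i j k l = 0.
Proof.
rewrite /d_of; under eq_bigr do rewrite wE.
by rewrite !(big_split, sumrN) /= !sum_dotted3 !sumr_ord_const; ring.
Qed.

Lemma d_of_sum4 i j k : \sum_l d_of w i j k l = 0.
Proof.
rewrite /d_of; under eq_bigr do rewrite wE.
by rewrite !(big_split, sumrN) /= !sum_dotted4 !sumr_ord_const; ring.
Qed.

Lemma a_of_row i : \sum_j a_of w i j = 0.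
Proof.
rewrite /a_of !(big_split, sumrN) /= !sum_dotted3 !sum_dotted4 !sumr_ord_const.
by ring.
Qed.

Lemma Q_decomposition s : Q w s = Q (d_of w) s
  + N%:R * linear_stat (a_of w) s + N%:R ^+ 2 * dotted w None None None None.
Proof.
set m := dotted w; pose n : R := N%:R.
pose A := \sum_i m (Some i) None (Some (s i)) None.
pose B := \sum_j m None (Some j) None (Some (s j)).
have sumS f : \sum_i f (s i) = \sum_i f i :> R.
  by rewrite [RHS](reindex_inj (@perm_inj _ s)).
have s3 i j l : \sum_k m i j (Some (s k)) l = n * m i j None l.
  by rewrite (sumS (fun k => m i j (Some k) l)) /m sum_dotted3.
have s4 i j k : \sum_l m i j k (Some (s l)) = n * m i j k None.
  by rewrite (sumS (fun l => m i j k (Some l))) /m sum_dotted4.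
pose mu := m None None None None.
have s1 j k l : \sum_i m (Some i) j k l = n * m None j k l by exact: sum_dotted1.
have s2 i k l : \sum_j m i (Some j) k l = n * m i None k l by exact: sum_dotted2.
(* Apart from [w] itself, a term containing both [i] and [s i] sums to [n A], one containing both
   [j] and [s j] to [n B], and any other to [n ^ 2 mu]. *)
have c1 : \sum_i \sum_(j < N) m (Some i) None None None = n ^+ 2 * mu.
  under eq_bigr do rewrite sumr_ord_const.
  by rewrite -mulr_sumr s1 mulrA -expr2.
have c2 : \sum_(i < N) \sum_j m None (Some j) None None = n ^+ 2 * mu.
  by rewrite sumr_ord_const s2 mulrA -expr2.
have c3 : \sum_i \sum_(j < N) m None None (Some (s i)) None = n ^+ 2 * mu.
  under eq_bigr do rewrite sumr_ord_const.
  by rewrite -mulr_sumr s3 mulrA -expr2.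
have c4 : \sum_(i < N) \sum_j m None None None (Some (s j)) = n ^+ 2 * mu.
  by rewrite sumr_ord_const s4 mulrA -expr2.
have c12 : \sum_i \sum_j m (Some i) (Some j) None None = n ^+ 2 * mu.
  under eq_bigr do rewrite s2.
  by rewrite -mulr_sumr s1 mulrA -expr2.
have c13 : \sum_i \sum_(j < N) m (Some i) None (Some (s i)) None = n * A.
  under eq_bigr do rewrite sumr_ord_const.
  by rewrite -mulr_sumr.
have c14 : \sum_i \sum_j m (Some i) None None (Some (s j)) = n ^+ 2 * mu.
  under eq_bigr do rewrite s4.
  by rewrite -mulr_sumr s1 mulrA -expr2.
have c23 : \sum_i \sum_j m None (Some j) (Some (s i)) None = n ^+ 2 * mu.
  under eq_bigr do rewrite s2.
  by rewrite -mulr_sumr s3 mulrA -expr2.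
have c24 : \sum_(i < N) \sum_j m None (Some j) None (Some (s j)) = n * B.
  by rewrite sumr_ord_const.
have c34 : \sum_i \sum_j m None None (Some (s i)) (Some (s j)) = n ^+ 2 * mu.
  under eq_bigr do rewrite s4.
  by rewrite -mulr_sumr s3 mulrA -expr2.
have c123 : \sum_i \sum_j m (Some i) (Some j) (Some (s i)) None = n * A.
  under eq_bigr do rewrite s2.
  by rewrite -mulr_sumr.
have c124 : \sum_i \sum_j m (Some i) (Some j) None (Some (s j)) = n * B.
  by rewrite exchange_big; under eq_bigr do rewrite s1; rewrite -mulr_sumr.
have c134 : \sum_i \sum_j m (Some i) None (Some (s i)) (Some (s j)) = n * A.
  under eq_bigr do rewrite s4.
  by rewrite -mulr_sumr.
have c234 : \sum_i \sum_j m None (Some j) (Some (s i)) (Some (s j)) = n * B.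
  by rewrite exchange_big; under eq_bigr do rewrite s3; rewrite -mulr_sumr.
have Qd : Q (d_of w) s = Q w s - n * A - n * B + n ^+ 2 * mu.
  rewrite /Q /d_of -/m.
  under eq_bigr do rewrite !(big_split, sumrN) /=.
  rewrite !(big_split, sumrN) /= c1 c2 c3 c4 c12 c13 c14 c23 c24 c34 c123 c124 c134 c234.
  have -> : \sum_(i < N) \sum_(j < N) m None None None None = n ^+ 2 * mu.
    by rewrite !sumr_ord_const mulrA -expr2.
  by ring.
have aE : linear_stat (a_of w) s = A + B - 2 * n * mu.
  rewrite /linear_stat /a_of -/m !(big_split, sumrN) /=.
  rewrite s1 s2 s3 s4 !sumr_ord_const -/A -/B -/n -/mu.
  by ring.
by rewrite Qd aE /mu /n; ring.
Qed.

Lemma avg_linear_stat (b : 'I_N -> 'I_N -> R) :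
  (forall i, \sum_k b i k = 0) -> avg (linear_stat b) = 0.
Proof.
move=> b0; rewrite /linear_stat avg_sum big1// => i _.
by rewrite (avg_perm1 i (b i)) b0 mulr0.
Qed.

Lemma Q_centered_decomposition s : Q w s - avg (Q w) =
  (Q (d_of w) s - avg (Q (d_of w))) +
  linear_stat (fun i j => N%:R * a_of w i j) s.
Proof.
have linE u : N%:R * linear_stat (a_of w) u =
    linear_stat (fun i j => N%:R * a_of w i j) u by rewrite /linear_stat mulr_sumr.
rewrite (eq_avg Q_decomposition) !avgD (avg_cst (1%g : 'S_N)) avgZ.
rewrite (avg_linear_stat a_of_row) Q_decomposition linE.
by ring.
Qed.

End HoeffdingDecomposition.

(** * From exponential moments to tail bounds *)

Section Chernoff.
Variable R : realType.

(* The exponent [- lam t / 2 + C lam ^ 2 V] is evaluated at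
   [lam = t / (4 C (V + B t))]. *)
Lemma bernstein_of_mgf (T : finType) (x0 : T) (Z : T -> R) (C V B t : R) :
  0 < C -> 0 <= V -> 0 <= B -> 0 < t ->
  (forall lam, 0 <= lam -> lam * B <= (4 * C)^-1 ->
    avg (fun x => expR (lam * Z x)) <= expR (C * lam ^+ 2 * V)) ->
  ((avg (fun x => (t / 2 <= Z x)%R%:R))%:E <=
    bernstein_bound (16 * C)^-1 V B t)%E.
Proof.
move=> C0 V0 B0 t0 mgf.
have markov lam : 0 <= lam -> lam * B <= (4 * C)^-1 ->
    avg (fun x => (t / 2 <= Z x)%R%:R) <=
    expR (- (lam * (t / 2)) + C * lam ^+ 2 * V).
  move=> l0 lB; rewrite expRD.
  apply: (@le_trans _ _ (expR (- (lam * (t / 2))) * avg (fun x => expR (lam * Z x)))).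
    rewrite -avgZ; apply: ler_avg => x; rewrite -expRD.
    case: (boolP (t / 2 <= Z x)) => [h|_]; last exact: expR_ge0.
    apply: le_trans (expR_ge1Dx _); rewrite /= lerDl addrC subr_ge0.
    exact: ler_wpM2l.
  by rewrite ler_wpM2l ?expR_ge0// mgf.
rewrite /bernstein_bound.
have VB0 : 0 <= V + B * t by rewrite addr_ge0// mulr_ge0// ltW.
(* If the denominator vanishes, then so do [V] and [B], and every [lam >= 0] is admissible:
   [lam = 2 / (t eps)] bounds the probability by [exp (- 1 / eps) <= eps]. *)
have [VBE|VBn0] := eqVneq (V + B * t) 0.
  have [V1 B1] : V = 0 /\ B = 0.
    have h := mulr_ge0 B0 (ltW t0); have BE : B * t = 0 by lra.
    split; first by lra.
    by apply/eqP; move/eqP: BE; rewrite mulf_eq0 [t == 0]gt_eqF// orbF.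
  rewrite VBE inve0 gt0_muley ?lte_fin ?mulr_gt0 ?invr_gt0 ?mulr_gt0 ?exprn_gt0//.
  rewrite /= lee_fin; apply/ler_addgt0Pl => eps eps0; rewrite addr0.
  have l0 : 0 <= 2 / (t * eps) by rewrite divr_ge0// mulr_ge0// ltW.
  have := markov (2 / (t * eps)) l0; rewrite B1 mulr0 invr_ge0 => /(_ (mulr_ge0 (ler0n _ 4) (ltW C0))).
  rewrite V1 mulr0 addr0 => /le_trans; apply.
  have -> : 2 / (t * eps) * (t / 2) = eps^-1 by field; rewrite !gt_eqF.
  rewrite expRN invf_ple ?posrE ?expR_gt0//.
  by apply: le_trans (expR_ge1Dx _); rewrite lerDr.
have VBp : 0 < V + B * t by rewrite lt0r VBn0.
rewrite inver (negbTE VBn0) -EFinM -EFinN /= lee_fin.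
pose lam := (4 * C)^-1 * (t / (V + B * t)).
have C4 : 0 <= (4 * C)^-1 by rewrite invr_ge0 mulr_ge0// ltW.
have l0 : 0 <= lam by apply: mulr_ge0 => //; rewrite divr_ge0// ltW.
apply: (le_trans (markov lam l0 _)).
  by rewrite /lam -mulrA ler_piMr// mulrAC ler_pdivrMr//; lra.
rewrite ler_expR.
have h : V / (V + B * t) <= 1 by rewrite ler_pdivrMr// mul1r lerDl mulr_ge0// ltW.
pose q := t ^+ 2 / (V + B * t).
have q0 : 0 <= q by rewrite divr_ge0 ?sqr_ge0.
have -> : lam * (t / 2) = (8 * C)^-1 * q.
  by rewrite /lam /q; field; rewrite !gt_eqF.
have -> : C * lam ^+ 2 * V = (16 * C)^-1 * (q * (V / (V + B * t))).
  by rewrite /lam /q; field; rewrite !gt_eqF.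
have -> : (16 * C)^-1 * t ^+ 2 / (V + B * t) = (16 * C)^-1 * q.
  by rewrite /q [RHS]mulrA.
have c0 : 0 <= (16 * C)^-1 by rewrite invr_ge0 mulr_ge0// ltW.
(* With [c = 1 / (16 C)] the exponent is [- 2 c q + c q V / (V + B t)], at most [- c q]. *)
have := ler_wpM2l (mulr_ge0 c0 q0) h.
set c := (16 * C)^-1; have -> : (8 * C)^-1 = 2 * c by rewrite /c; field; rewrite gt_eqF.
by rewrite mulr1 mulrA; lra.
Qed.

End Chernoff.

Local Open Scope classical_set_scope.
Local Open Scope ring_scope.

(** * Uniform random permutations on a probability space *)

Section UniformPermutation.
Variables (R : realType) (dsp : measure_display) (T : measurableType dsp).
Variables (P : probability T R) (N : nat) (p : T -> 'S_N).
Hypothesis pU : uniform_permutation P p.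

(** [f (p y)] is a finite linear combination of indicators of the events [p = s]. *)
Lemma expectation_uniform_permutation (f : 'S_N -> R) :
  ('E_P[fun y => f (p y)] = (avg f)%:E)%E.
Proof.
have mp s : measurable (p @^-1` [set s]) by have [] := pU s.
have fE y : (f (p y))%:E = (\sum_s (f s)%:E * (\1_(p @^-1` [set s]) y)%:E)%E.
  rewrite (bigD1 (p y))//= big1 => [|s sp]; last first.
    rewrite indicE memNset ?mule0//= => ps; by rewrite ps eqxx in sp.
  by rewrite adde0 indicE mem_set// mule1.
rewrite unlock; under eq_integral do rewrite fE.
rewrite integral_sum//; last first.
  by move=> s; apply: integrableZl => //; exact: integrable_indic.
transitivity (\sum_s ((f s * #|{: 'S_N}|%:R^-1)%:E))%E.
  apply: eq_bigr => s _; rewrite integralZl//; last exact: integrable_indic.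
  have [_ Ps] := pU s.
  rewrite integral_indic// setIT EFinM; congr (_ * _)%E.
  by rewrite card_Sn; exact: Ps.
by rewrite sumEFin -mulr_suml mulrC.
Qed.

Lemma probability_uniform_permutation (A : pred 'S_N) :
  P [set x | A (p x)] = (avg (fun s => (A s)%:R))%:E.
Proof.
have mA : measurable [set x | A (p x)].
  have -> : [set x | A (p x)] = \big[setU/set0]_(s | A s) (p @^-1` [set s]).
    rewrite -bigcup_pred; apply/seteqP; split => [x /= Ax|x /= [s As ->//]].
    by exists (p x).
  by apply: bigsetU_measurable => s _; have [] := pU s.
rewrite -expectation_indic// -expectation_uniform_permutation; congr expectation.
apply/funext => x; rewrite indicE; congr (nat_of_bool _)%:R.
apply/idP/idP => [/set_mem//|Ax]; exact/mem_set.
Qed.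

End UniformPermutation.

Unset Implicit Arguments.

Theorem corollary2p1 (R : realType) :
  exists2 K : R, 0 < K &
    forall (N : nat) (w : 'I_N -> 'I_N -> 'I_N -> 'I_N -> R)
      (d : measure_display) (T : measurableType d) (P : probability T R)
      (p : T -> 'S_N) (t : R),
    (20 <= N)%N -> uniform_permutation P p -> 0 < t ->
    (P [set x | t%:E <= (Q w (p x))%:E - 'E_P[fun y => Q w (p y)]] <=
     bernstein_bound K (V_a w) (B_a w) t + bernstein_bound K (V_d w) (B_d w) t)%E.
Proof.
have [C C0 CE] : exists2 C : R, 0 < C & C = 1600 ^+ 2.
  by exists (1600 ^+ 2); [apply: exprn_gt0; rewrite ltr0n | reflexivity].
(* The range of [lam] in the Chernoff argument lies within that of both exponential moment
   bounds. *)
have C1600 : (4 * C)^-1 <= 1600^-1.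
  rewrite lef_pV2 ?posrE ?ltr0n ?pmulr_lgt0 ?ltr0n //; first by rewrite CE; lra.
exists (16 * C)^-1; first by rewrite invr_gt0 mulr_gt0.
move=> N w d T P p t N20 pU t0.
have N0 : (0 < N)%N by exact: leq_trans N20.
have Np : 0 < N%:R :> R by rewrite ltr0n.
(* This scaling gives [|b| <= B_a w] and [N^-1 sum b ^ 2 = V_a w]. *)
pose b i j : R := N%:R * a_of w i j.
pose Z1 := linear_stat b; pose Z2 s := Q (d_of w) s - avg (Q (d_of w)).
have -> : [set x | (t%:E <= (Q w (p x))%:E - 'E_P[fun y => Q w (p y)])%E] =
    [set x | t <= Z2 (p x) + Z1 (p x)].
  apply/seteqP; split => x /=; rewrite (expectation_uniform_permutation pU) -EFinB lee_fin;
    by rewrite (Q_centered_decomposition N0).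
rewrite (probability_uniform_permutation pU (fun s => t <= Z2 s + Z1 s)).
(* Union bound: if the sum is at least [t], one of its two terms is at least [t / 2]. *)
apply: (@le_trans _ _ ((avg (fun s => (t / 2 <= Z1 s)%R%:R))%:E +
    (avg (fun s => (t / 2 <= Z2 s)%R%:R))%:E)%E).
  rewrite -EFinD lee_fin -avgD; apply: ler_avg => s.
  case: (lerP t) => [h|_]; last by rewrite addr_ge0.
  case: (lerP (t / 2) (Z1 s)) => h1; first by rewrite lerDl.
  case: (lerP (t / 2) (Z2 s)) => h2; first by rewrite lerDr.
  by lra.
have Va0 : 0 <= V_a w.
  apply: mulr_ge0 => //; do 2! [apply: sumr_ge0 => ? _]; exact: sqr_ge0.
have Ba0 : 0 <= B_a w by apply: mulr_ge0 => //; exact: bigmax_ge_id.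
have Bd0 : 0 <= B_d w by exact: bigmax_ge_id.
have Vd0 : 0 <= V_d w.
  apply: addr_ge0; apply: mulr_ge0; rewrite ?invr_ge0 ?exprn_ge0//.
    do 2! [apply: sumr_ge0 => ? _]; exact: sqr_ge0.
  do 4! [apply: sumr_ge0 => ? _]; exact: sqr_ge0.
apply: leeD.
- apply: (bernstein_of_mgf (1%g : 'S_N) (Z := Z1) C0) => // lam l0 lB.
  have b0 i : \sum_k b i k = 0 by rewrite /b -mulr_sumr (a_of_row N0) mulr0.
  have bB i k : `|b i k| <= B_a w.
    rewrite normrM ger0_norm// ler_wpM2l//.
    by apply: (le_trans _ (le_bigmax _ _ i)); exact: le_bigmax.
  apply: (le_trans (linear_mgf N20 b0 bB _)).
    by rewrite ger0_norm//; have := le_trans lB C1600; lra.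
  have -> : N%:R^-1 * \sum_i \sum_k b i k ^+ 2 = V_a w.
    rewrite /V_a /b mulr_sumr mulr_sumr; apply: eq_bigr => i _.
    rewrite mulr_sumr mulr_sumr; apply: eq_bigr => k _.
    by field; rewrite gt_eqF.
  by rewrite ler_expR CE; have := mulr_ge0 (sqr_ge0 lam) Va0; lra.
apply: (bernstein_of_mgf (1%g : 'S_N) (Z := Z2) C0) => // lam l0 lB.
rewrite CE; apply: (degenerate_mgf N20 Bd0 (op_bounded_d_of w)).
- exact: d_of_sum1.
- exact: d_of_sum2.
- exact: d_of_sum3.
- exact: d_of_sum4.
by rewrite ger0_norm//; exact: le_trans lB C1600.
Qed.
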